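(* Let $F$ be an algebraically closed field. There is a sequence of natural ring homomorphisms of Grothendieck rings $$\mathbf{Gr}^\infty(F^{\mathrm{pp}})\to\mathbf{Gr}(F^{\mathrm{form}})\to\mathbf{Gr}(F^{\mathrm{var}}),$$ where the first is the quotient map and the second sends the class of a formulary $\Phi$ to the class of a quantifier free formula defining the subset $\Phi(F)$ over $F$.
   Context: $\mathcal L_F$ is the first-order language of $F$-algebras. A schemic formula is a finite conjunction of equations $f(x)=0$ with $f\in F[x]$, $x=(x_1,\dots,x_n)$; a pp-formula is $(\exists y)\psi(x,y)$ with $\psi$ schemic; $\mathcal{PP}$ is the Boolean closure of the pp-formulae. $\mathbf{Art}_F$ is the class of Artinian local $F$-algebras (finite-dimensional over $F$). For a set $\Phi$ of formulae of arity $n$ and $R\in\mathbf{Art}_F$, put $\Phi(R):=\bigcup_{\phi\in\Phi}\phi(R)\subseteq R^n$. $\Phi$ is a formulary if for each $R\in\mathbf{Art}_F$ there is $\phi\in\Phi$ with $\phi(R)=\Phi(R)$; formularies are equivalent if they define the same set in all $R\in\mathbf{Art}_F$. $\mathcal{PP}^\infty$ is the lattice (up to equivalence) of formularies consisting of formulae in $\mathcal{PP}$, with $\Phi\wedge\Psi=\{\phi\wedge\psi\}$, $\Phi\vee\Psi=\Phi\cup\Psi$. A schemic isomorphism $\Phi\to\Psi$ is given by a schemic formula $\theta(x,y)$ such that for each $R\in\mathbf{Art}_F$, $\theta(R)$ restricted to $\Phi(R)$ is the graph of a bijection $\Phi(R)\to\Psi(R)$, the inverses also being given by a schemic formula. $\mathbf{Gr}^\infty(F^{\mathrm{pp}})$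 is the free Abelian group on $\mathcal{PP}^\infty$ modulo all $\langle\Phi\rangle-\langle\Psi\rangle$ with $\Phi,\Psi$ schemically isomorphic and all $\langle\Phi\vee\Psi\rangle+\langle\Phi\wedge\Psi\rangle-\langle\Phi\rangle-\langle\Psi\rangle$, a commutative ring with product induced by $\Phi\times\Psi=\{\phi(x)\wedge\psi(y)\}$ ($x,y$ disjoint). The class of an affine $F$-scheme of finite type is the class of a schemic formula defining it. For a closed immersion $Y\subseteq V$ of affine $F$-schemes, $V=\operatorname{Spec}B\subseteq\mathbb A^n_F$, with $Y$ defined by the ideal $I\subseteq B$, the total jet $J_YV$ is the formulary of all schemic formulae defining $\operatorname{Spec}(B/I^k)\subseteq\mathbb A^n_F$, $k\ge1$. The formal Grothendieck ring $\mathbf{Gr}(F^{\mathrm{form}})$ is the quotient of $\mathbf{Gr}^\infty(F^{\mathrm{pp}})$ by the ideal $\mathfrak N$ generated by all $[J_YV]-[Y]$. The classical Grothendieck ring $\mathbf{Gr}(F^{\mathrm{var}})$ is the free Abelian group on quantifier free $\mathcal L_F$-formulae, taken up to equivalence in all algebraically closed fields containing $F$, modulo all $\langle\phi\vee\psi\rangle+\langle\phi\wedge\psi\rangle-\langle\phi\rangle-\langle\psi\rangle$ and all $\langle\phi\rangle-\langle\phi'\rangle$ for which there is a bijection between the sets defined by $\phi$ and $\phi'$ (in all such fields) which, together with its inverse, is given by a tuple of polynomials over $F$; product $[\phi][\psi]=[\phi(x)\wedge\psi(y)]$, with $x,y$ disjoint.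
   Formalization: In Gr(F^var), a bijection and its inverse are ''given by polynomials'' if their graphs are cut out by polynomials in (x,y); with polynomial maps [x≠0] ≠ [uv=1] and the second map fails to exist. The join of formularies is {φ∨ψ}, as a union need not be a formulary. *)

(* Defs.v *)
From HB Require Import structures.
From mathcomp Require Import all_boot all_order all_algebra all_field.
From mathcomp Require Import boolp classical_sets functions.
From mathcomp Require Import mpoly freeg.

Set Implicit Arguments.
Unset Strict Implicit.
Unset Printing Implicit Defensive.

Import GRing.Theory.

Local Open Scope classical_set_scope.
Local Open Scope quotient_scope.
Local Open Scope ring_scope.

Section SubgroupGeneratedBy.
Variables (A : zmodType) (S : set A).

Definition subgroup_gen : {pred A} :=
  fun a => `[< forall I : {pred A},
                 zmod_closed I -> (forall b, S b -> b \in I) -> a \in I >].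

Lemma subgroup_genP a :
  reflect (forall I : {pred A},
             zmod_closed I -> (forall b, S b -> b \in I) -> a \in I)
          (a \in subgroup_gen).
Proof. exact: asboolP. Qed.

Lemma subgroup_gen_closed : zmod_closed subgroup_gen.
Proof.
split; first by apply/subgroup_genP => I [I0 _] _.
move=> a b /subgroup_genP Na /subgroup_genP Nb; apply/subgroup_genP => I cI SI.
by case: (cI) => _ cB; apply: cB; [apply: Na | apply: Nb].
Qed.

HB.instance Definition _ := GRing.isZmodClosed.Build A subgroup_gen
  subgroup_gen_closed.

Lemma subgroup_gen_sub a : S a -> a \in subgroup_gen.
Proof. by move=> Sa; apply/subgroup_genP => I _; apply. Qed.

End SubgroupGeneratedBy.

Definition ideal_gen (R : comPzRingType) (S : set R) : set R :=
  [set a | exists2 s : seq (R * R),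
     forall p, p \in s -> S p.2 & a = \sum_(p <- s) p.1 * p.2].

Section IdealTheory.
Variables (R : comPzRingType) (S : set R).

Lemma ideal_gen_sub a : S a -> ideal_gen S a.
Proof.
by move=> Sa; exists [:: (1, a)]; [move=> p /[1!inE] /eqP -> | rewrite big_seq1 mul1r].
Qed.

Lemma ideal_gen0 : ideal_gen S 0.
Proof. by exists [::]; rewrite ?big_nil. Qed.

Lemma ideal_genD a b : ideal_gen S a -> ideal_gen S b -> ideal_gen S (a + b).
Proof.
move=> [s Ss ->] [t St ->]; exists (s ++ t); last by rewrite big_cat.
by move=> p; rewrite mem_cat => /orP[/Ss|/St].
Qed.

Lemma ideal_genM c a : ideal_gen S a -> ideal_gen S (c * a).
Proof.
move=> [s Ss ->]; exists [seq (c * p.1, p.2) | p <- s].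
  by move=> _ /mapP[p /Ss Sp ->].
by rewrite big_map mulr_sumr; apply: eq_bigr => p _; rewrite mulrA.
Qed.

Lemma ideal_gen_sum (I : Type) (r : seq I) (P : pred I) (E : I -> R) :
  (forall i, P i -> ideal_gen S (E i)) -> ideal_gen S (\sum_(i <- r | P i) E i).
Proof.
move=> SE; elim/big_rec: _ => [|i x Pi]; first exact: ideal_gen0.
exact/ideal_genD/SE.
Qed.

Definition in_ideal_gen : {pred R} := fun a => `[< ideal_gen S a >].

Lemma in_ideal_genP a : reflect (ideal_gen S a) (a \in in_ideal_gen).
Proof. exact: asboolP. Qed.

Lemma in_ideal_gen_closed : zmod_closed in_ideal_gen.
Proof.
split; first exact/in_ideal_genP/ideal_gen0.
move=> a b /in_ideal_genP Sa /in_ideal_genP Sb; apply/in_ideal_genP.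
by apply: ideal_genD Sa _; rewrite -mulN1r; apply: ideal_genM.
Qed.

HB.instance Definition _ := GRing.isZmodClosed.Build R in_ideal_gen
  in_ideal_gen_closed.

End IdealTheory.

Lemma ideal_gen_least (R : comPzRingType) (S T : set R) :
  (forall a, S a -> ideal_gen T a) -> ideal_gen S `<=` ideal_gen T.
Proof.
move=> ST a [s Ss ->]; rewrite big_seq.
by apply: (@ideal_gen_sum _ _ _ s (mem s)) => p /Ss Sp; apply/ideal_genM/ST.
Qed.

(* I ^ k, for an ideal I; I ^ 0 is the unit ideal. *)
Definition ideal_exp (R : comPzRingType) (I : set R) (k : nat) : set R :=
  ideal_gen [set a | exists2 s : seq R,
     size s = k /\ (forall b, b \in s -> I b) & a = \prod_(b <- s) b].

(* The library's ring quotients are by proper ideals only, and the product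
   below lives on a group A that need not be a ring: it is only required to
   be a commutative ring product modulo N. *)
Section QuotientRing.
Variables (A : zmodType) (N : zmodClosed A) (one : A) (mul : A -> A -> A).
Hypothesis mulDl : forall a b c, mul (a + b) c = mul a c + mul b c.
Hypothesis mulNl : forall a b, a \in N -> mul a b \in N.
Hypothesis mulC : forall a b, mul a b - mul b a \in N.
Hypothesis mulA : forall a b c, mul a (mul b c) - mul (mul a b) c \in N.
Hypothesis mul1 : forall a, mul one a - a \in N.

Local Notation Q := (Quotient.quot N).
Local Notation pi := (\pi_Q : A -> Q).

Lemma pi_eqP a b : a - b \in N <-> pi a = pi b.
Proof. by split=> [|/eqP]; rewrite Quotient.idealrBE => // /eqP. Qed.

Definition quot_one : Q := pi one.
Definition quot_mul (x y : Q) : Q := pi (mul (repr x) (repr y)).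

Lemma pi_mulC a b : pi (mul a b) = pi (mul b a).
Proof. exact/pi_eqP/mulC. Qed.

Lemma pi_mull a a' b : pi a = pi a' -> pi (mul a b) = pi (mul a' b).
Proof.
move=> /pi_eqP /(mulNl b) ab; apply/pi_eqP.
by rewrite -{1}[a](subrK a') mulDl addrK.
Qed.

Lemma pi_quot_mul a b : pi (mul a b) = quot_mul (pi a) (pi b).
Proof.
rewrite /quot_mul (@pi_mull a (repr (pi a))) ?reprK // pi_mulC.
by rewrite (@pi_mull b (repr (pi b))) ?reprK // pi_mulC.
Qed.

Lemma quot_mulC : commutative quot_mul.
Proof. by move=> x y; apply: pi_mulC. Qed.

Lemma quot_mulA : associative quot_mul.
Proof.
elim/quotW=> a; elim/quotW=> b; elim/quotW=> c.
rewrite -(pi_quot_mul b c) -(pi_quot_mul a (mul b c)).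
rewrite -(pi_quot_mul a b) -(pi_quot_mul (mul a b) c).
exact/pi_eqP/mulA.
Qed.

Lemma quot_mul1 : left_id quot_one quot_mul.
Proof.
by elim/quotW=> a; rewrite -(pi_quot_mul one a); apply/pi_eqP/mul1.
Qed.

Lemma quot_mulDl : left_distributive quot_mul +%R.
Proof.
elim/quotW=> a; elim/quotW=> b; elim/quotW=> c.
rewrite -(raddfD (\pi_Q : {additive A -> Q})) /= -(pi_quot_mul (a + b) c).
by rewrite -(pi_quot_mul a c) -(pi_quot_mul b c) mulDl raddfD.
Qed.

End QuotientRing.

Section Schemic.
Variable F : fieldType.

(* A commutative F-algebra, as a ring under F: this covers both the finite
   dimensional algebras and the field extensions of F. *)
Record model := Model {
  carrier :> comNzRingType;
  scalar : {rmorphism F -> carrier}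
}.

Definition peval (M : model) n (v : 'rV[M]_n) (p : {mpoly F[n]}) : M :=
  mmap (scalar M) (v 0) p.

HB.instance Definition _ (M : model) n (v : 'rV[M]_n) :=
  GRing.RMorphism.copy (peval v) (mmap (scalar M) (v 0)).

(* The finite conjunction of the equations f = 0, for f in the sequence. *)
Definition schemic n := seq {mpoly F[n]}.

Definition schemic_set n (s : schemic n) (M : model) : set 'rV[M]_n :=
  [set v | forall f, f \in s -> peval v f = 0].

Definition rename n k (s : 'I_n -> 'I_k) (p : {mpoly F[n]}) : {mpoly F[k]} :=
  mmap (@mpolyC k F) (fun i => 'X_(s i)) p.

Lemma pevalX (M : model) n (v : 'rV[M]_n) i : peval v 'X_i = v 0 i.
Proof. by rewrite /peval mmapX mmap1U. Qed.

Lemma peval_rename (M : model) n k (s : 'I_n -> 'I_k) (v : 'rV[M]_k) p :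
  peval v (rename s p) = peval (\row_i v 0 (s i)) p.
Proof.
rewrite /rename [in LHS]/mmap raddf_sum /=; apply: eq_bigr => m _.
rewrite rmorphM /= [in LHS]/peval mmapC -/(peval v _); congr (_ * _).
rewrite [in LHS]/mmap1 rmorph_prod /=; apply: eq_bigr => i _.
by rewrite rmorphXn /= pevalX mxE.
Qed.

Definition var_eqs l n (s t : 'I_l -> 'I_n) : schemic n :=
  [seq 'X_(s i) - 'X_(t i) | i <- enum 'I_l].

Lemma var_eqsP l n (s t : 'I_l -> 'I_n) (M : model) (v : 'rV[M]_n) :
  schemic_set (var_eqs s t) v <-> forall i, v 0 (s i) = v 0 (t i).
Proof.
split=> [eq_v i|eq_v _ /mapP[i _ ->]]; last first.
  by rewrite raddfB /= !pevalX eq_v subrr.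
have /eq_v : 'X_(s i) - 'X_(t i) \in var_eqs s t.
  by apply/mapP; exists i; rewrite ?mem_enum.
by rewrite raddfB /= !pevalX => /eqP; rewrite subr_eq0 => /eqP.
Qed.

Lemma schemic_cat n (s t : schemic n) (M : model) (v : 'rV[M]_n) :
  schemic_set (s ++ t) v <-> schemic_set s v /\ schemic_set t v.
Proof.
split=> [st|[sv tv] f]; last by rewrite mem_cat => /orP[/sv|/tv].
by split=> f fs; apply: st; rewrite mem_cat fs ?orbT.
Qed.

Lemma schemic_rename n k (s : 'I_n -> 'I_k) (e : schemic n) (M : model)
    (v : 'rV[M]_k) :
  schemic_set (map (rename s) e) v <-> schemic_set e (\row_i v 0 (s i)).
Proof.
split=> [ev f fe|ev _ /mapP[f fe ->]]; last by rewrite peval_rename ev.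
by rewrite -peval_rename; apply/ev/mapP; exists f.
Qed.

(* A class of formulae, interpreted in a class of models.  The sets form_set
   of a formula are only relevant in the models of the class. *)
Record theory := Theory {
  is_model : model -> Prop;
  form : nat -> Type;
  form_set : forall n, form n -> forall M : model, set 'rV[M]_n;
  form_and : forall n, form n -> form n -> form n;
  form_or : forall n, form n -> form n -> form n;
  form_prod : forall n k, form n -> form k -> form (n + k);
  form_true : form 0;
  form_andP : forall n (p q : form n) M, is_model M ->
    @form_set n (form_and p q) M = @form_set n p M `&` @form_set n q M;
  form_orP : forall n (p q : form n) M, is_model M ->
    @form_set n (form_or p q) M = @form_set n p M `|` @form_set n q M;
  form_prodP : forall n k (p : form n) (q : form k) M, is_model M ->
    @form_set (n + k) (form_prod p q) M =
      [set v | @form_set n p M (lsubmx v) /\ @form_set k q M (rsubmx v)];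
  form_trueP : forall M, is_model M -> @form_set 0 form_true M = setT
}.

Arguments form_set {t n} p M _.

Section Grothendieck.
Variable T : theory.

Definition form_equiv n (p q : form T n) :=
  forall M, is_model T M -> form_set p M = form_set q M.

(* The bijection f is given by the tuple th of polynomials in (x, y), whose
   zeros above form_set p M form the graph of f, and its inverse likewise by
   th'.  Both tuples are the same for all models, and need not consist of
   polynomials y_j - g_j(x): over algebraically closed fields, a bijection and
   its inverse that are both polynomial maps extend to the Zariski closures, so
   allowing only these would separate x != 0 from x y = 1, whereas the pp-formula
   (exists z) x z = 1 is isomorphic to x y = 1 in all Artinian local algebras. *)
Definition schemic_iso n k (p : form T n) (q : form T k) :=
  exists (th : schemic (n + k)) (th' : schemic (k + n)),
  forall M, is_model T M -> exists f : 'rV[M]_n -> 'rV[M]_k,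
  [/\ set_bij (form_set p M) (form_set q M) f,
      forall x y, form_set p M x -> (schemic_set th (row_mx x y) <-> y = f x)
    & forall y x, form_set q M y ->
        (schemic_set th' (row_mx y x) <-> form_set p M x /\ f x = y)].

Definition generator := {n & form T n}.
HB.instance Definition _ := gen_eqMixin generator.
HB.instance Definition _ := gen_choiceMixin generator.

Local Notation A := {freeg generator / int}.

Definition gen n (p : form T n) : A := << existT _ n p : generator >>.

Inductive gr_relation : set A :=
| gr_equiv n (p q : form T n) of form_equiv p q : gr_relation (gen p - gen q)
| gr_iso n k (p : form T n) (q : form T k) of schemic_iso p q :
    gr_relation (gen p - gen q)
| gr_scissor n (p q : form T n) :
    gr_relation (gen (form_or p q) + gen (form_and p q) - gen p - gen q).

Definition gr_sub : {pred A} := subgroup_gen gr_relation.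
HB.instance Definition _ := GRing.ZmodClosed.on gr_sub.

Definition gen_mul (x y : generator) : A := gen (form_prod (projT2 x) (projT2 y)).

Definition freeg_mul (a b : A) : A := fglift (fun x => fglift (gen_mul x) b) a.

Definition freeg_one : A := gen (form_true T).

Lemma split_lshift n k (j : 'I_n) : fintype.split (lshift k j) = inl j.
Proof. exact: (unsplitK (inl j)). Qed.

Lemma split_rshift n k (j : 'I_k) : fintype.split (rshift n j) = inr j.
Proof. exact: (unsplitK (inr j)). Qed.

Lemma subrACA (V : zmodType) (a b c d : V) : a - b - (c - d) = a - c - (b - d).
Proof. by rewrite !opprB addrACA [RHS]addrACA [- b - c]addrC. Qed.

Lemma freeg_gen_ind (P : A -> Prop) :
    P 0 -> (forall a b, P a -> P b -> P (a - b)) ->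
    (forall n (p : form T n), P (gen p)) ->
  forall a, P a.
Proof.
move=> P0 PB Pgen; have PN a : P a -> P (- a).
  by move=> Pa; rewrite -sub0r; apply: PB.
have PD a b : P a -> P b -> P (a + b).
  by move=> Pa Pb; rewrite -[b]opprK; apply/PB/PN.
have PM a m : P a -> P (a *+ m).
  by move=> Pa; elim: m => [|m IHm]; rewrite ?mulr0n // mulrS; apply: PD.
move=> a; rewrite -(freeg_sumE a); elim/big_rec: _ => // [[n p]] x _.
apply: PD; rewrite -[coeff _ _]intz -freegU_mulz.
case: (coeff _ _) => m; first by rewrite -pmulrn; apply/PM/Pgen.
by rewrite NegzE mulrNz -pmulrn; apply/PN/PM/Pgen.
Qed.

Lemma fglift_additive (M : lmodType int) (f : generator -> M) a b :
  fglift f (a - b) = fglift f a - fglift f b.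
Proof. exact: lift_is_additive. Qed.

Lemma fglift_gen (M : lmodType int) (f : generator -> M) n (p : form T n) :
  fglift f (gen p) = f (existT _ n p).
Proof. by rewrite liftU scale1r. Qed.

Lemma freeg_mulBl a b c : freeg_mul (a - b) c = freeg_mul a c - freeg_mul b c.
Proof. exact: fglift_additive. Qed.

Lemma freeg_mul0l c : freeg_mul 0 c = 0.
Proof. by have := freeg_mulBl 0 0 c; rewrite !subrr. Qed.

Lemma freeg_mulDl a b c : freeg_mul (a + b) c = freeg_mul a c + freeg_mul b c.
Proof.
by rewrite -{1}[b]opprK -[- b]add0r !freeg_mulBl freeg_mul0l sub0r opprK.
Qed.

Lemma freeg_mulBr a b c : freeg_mul a (b - c) = freeg_mul a b - freeg_mul a c.
Proof.
elim/freeg_gen_ind: a => [|a a' IHa IHa'|n p]; first by rewrite !freeg_mul0l subrr.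
  by rewrite !freeg_mulBl IHa IHa' subrACA.
by rewrite /freeg_mul !fglift_gen fglift_additive.
Qed.

Lemma freeg_mul0r c : freeg_mul c 0 = 0.
Proof. by have := freeg_mulBr c 0 0; rewrite !subrr. Qed.

Lemma freeg_mul_gen n k (p : form T n) (q : form T k) :
  freeg_mul (gen p) (gen q) = gen (form_prod p q).
Proof. by rewrite /freeg_mul !fglift_gen. Qed.

Lemma gr_subB a b : a \in gr_sub -> b \in gr_sub -> a - b \in gr_sub.
Proof. exact: rpredB. Qed.

Lemma gr_sub_rel a : gr_relation a -> a \in gr_sub.
Proof. exact: subgroup_gen_sub. Qed.

Lemma schemic_iso_reindex n k (p : form T n) (q : form T k)
    (s : 'I_n -> 'I_k) (t : 'I_k -> 'I_n) :
    cancel s t -> cancel t s ->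
    (forall M, is_model T M -> forall v,
       form_set p M v <-> form_set q M (\row_j v 0 (t j))) ->
  schemic_iso p q.
Proof.
move=> sK tK pq.
exists (var_eqs (fun j => rshift n j) (fun j => lshift k (t j))).
exists (var_eqs (fun i => rshift k i) (fun i => lshift n (s i))).
move=> M MT; exists (fun v => \row_j v 0 (t j)).
have stK (w : 'rV[M]_k) : \row_j (\row_i w 0 (s i)) 0 (t j) = w.
  by apply/rowP=> j; rewrite !mxE tK.
split.
- split=> [v /(pq M MT v) //|v w _ _ /rowP vw|w qw].
    by apply/rowP=> i; have:= vw (s i); rewrite !mxE sK.
  by exists (\row_i w 0 (s i)); [apply/pq; rewrite ?stK | apply: stK].
- move=> v w _; rewrite var_eqsP; split=> [e|-> j].
    by apply/rowP=> j; have:= e j; rewrite row_mxEl row_mxEr mxE.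
  by rewrite row_mxEl row_mxEr mxE.
- move=> w v qw; rewrite var_eqsP; split=> [e|[_ <-] i]; last first.
    by rewrite row_mxEl row_mxEr mxE sK.
  have vE: v = \row_i w 0 (s i).
    by apply/rowP=> i; have:= e i; rewrite row_mxEl row_mxEr mxE.
  by rewrite vE; split; [apply/pq; rewrite ?stK | apply: stK].
Qed.

Definition prod_graph n k l (th : schemic (n + k)) : schemic ((n + l) + (k + l)) :=
  map (rename (fun i => match fintype.split i with
                        | inl a => lshift (k + l) (lshift l a)
                        | inr b => rshift (n + l) (lshift l b)
                        end)) th
  ++ var_eqs (fun i => lshift (k + l) (rshift n i))
             (fun i => rshift (n + l) (rshift k i)).

Lemma prod_graphP n k l (th : schemic (n + k)) (M : model)
    (v : 'rV[M]_(n + l)) (w : 'rV[M]_(k + l)) :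
  schemic_set (prod_graph l th) (row_mx v w) <->
  schemic_set th (row_mx (lsubmx v) (lsubmx w)) /\ rsubmx v = rsubmx w.
Proof.
rewrite schemic_cat schemic_rename var_eqsP.
have -> : (\row_i row_mx v w 0 match fintype.split i with
      | inl a => lshift (k + l) (lshift l a)
      | inr b => rshift (n + l) (lshift l b) end) = row_mx (lsubmx v) (lsubmx w).
  apply/rowP=> i; rewrite mxE; case: (split_ordP i) => j ->.
    by rewrite !row_mxEl mxE.
  by rewrite !row_mxEr mxE.
split=> -[thE e]; split=> //.
  by apply/rowP=> i; have:= e i; rewrite row_mxEl row_mxEr !mxE.
by move=> i; move/rowP/(_ i): e; rewrite row_mxEl row_mxEr !mxE.
Qed.

Lemma schemic_iso_prod n k l (p : form T n) (q : form T k) (r : form T l) :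
  schemic_iso p q -> schemic_iso (form_prod p r) (form_prod q r).
Proof.
move=> [th [th' iso]]; exists (prod_graph l th), (prod_graph l th') => M MT.
have [f [[fim finj fsurj] thP th'P]] := iso M MT.
exists (fun v => row_mx (f (lsubmx v)) (rsubmx v)); split.
- rewrite !form_prodP //; split.
  + by move=> v [pv rv] /=; rewrite row_mxKl row_mxKr; split=> //; apply: fim.
  + move=> v w; rewrite !inE => -[pv _] [pw _] /eq_row_mx[fvw vw].
    rewrite -[v]hsubmxK -[w]hsubmxK vw; congr row_mx.
    by apply: finj; rewrite ?inE.
  + move=> w [/fsurj[x px fx] rw]; exists (row_mx x (rsubmx w)).
      by rewrite /= row_mxKl row_mxKr.
    by rewrite row_mxKl row_mxKr fx hsubmxK.
- move=> v w; rewrite form_prodP // => -[pv rv]; rewrite prod_graphP thP //.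
  split=> [[fE rE]|->]; last by rewrite row_mxKl row_mxKr.
  by rewrite -[w]hsubmxK fE rE.
- move=> w v; rewrite !form_prodP // => -[qw rw]; rewrite prod_graphP th'P //.
  split=> [[[pv fE] rE]|[[pv rv] <-]]; last by rewrite row_mxKl row_mxKr.
  by rewrite fE -rE hsubmxK; split=> //; split=> //; rewrite -rE.
Qed.

Lemma gr_sub_iso n k (p : form T n) (q : form T k) :
  schemic_iso p q -> gen p - gen q \in gr_sub.
Proof. by move=> iso; apply/gr_sub_rel/gr_iso. Qed.

Lemma gr_sub_equiv n (p q : form T n) :
  form_equiv p q -> gen p - gen q \in gr_sub.
Proof. by move=> pq; apply/gr_sub_rel/gr_equiv. Qed.

Lemma freeg_mulNl a b : a \in gr_sub -> freeg_mul a b \in gr_sub.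
Proof.
move=> aN; elim/freeg_gen_ind: b => [|b b' IHb IHb'|l r].
- by rewrite freeg_mul0r /gr_sub rpred0.
- by rewrite freeg_mulBr gr_subB.
pose I : {pred A} := fun c => freeg_mul c (gen r) \in gr_sub.
suff: a \in I by [].
move: aN => /subgroup_genP; apply=> [|c].
  split; first by rewrite unfold_in freeg_mul0l /gr_sub rpred0.
  by move=> c c' Ic Ic'; rewrite unfold_in freeg_mulBl gr_subB.
case=> [n p q pq|n k p q pq|n p q]; rewrite unfold_in !freeg_mulBl ?freeg_mulDl !freeg_mul_gen.
- by apply: gr_sub_equiv => M MT; rewrite !form_prodP // (pq M MT).
- exact/gr_sub_iso/schemic_iso_prod.
set pr := form_prod p r; set qr := form_prod q r.
have e1 : gen (form_prod (form_or p q) r) - gen (form_or pr qr) \in gr_sub.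
  apply: gr_sub_equiv => M MT; rewrite !(form_prodP, form_orP) //.
  by apply/seteqP; split=> v /=; tauto.
have e2 : gen (form_and pr qr) - gen (form_prod (form_and p q) r) \in gr_sub.
  apply: gr_sub_equiv => M MT; rewrite !(form_prodP, form_andP) //.
  by apply/seteqP; split=> v /=; tauto.
have := rpredD (gr_subB e1 e2) (gr_sub_rel (gr_scissor pr qr)).
by rewrite opprB [X in X + _]addrACA -opprD -!(addrA (_ + _)) addKr.
Qed.

Lemma freeg_mulC a b : freeg_mul a b - freeg_mul b a \in gr_sub.
Proof.
elim/freeg_gen_ind: a => [|a a' IHa IHa'|n p].
- by rewrite freeg_mul0r freeg_mul0l subrr /gr_sub rpred0.
- by rewrite freeg_mulBl freeg_mulBr subrACA gr_subB.
elim/freeg_gen_ind: b => [|b b' IHb IHb'|k q].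
- by rewrite freeg_mul0r freeg_mul0l subrr /gr_sub rpred0.
- by rewrite freeg_mulBl freeg_mulBr subrACA gr_subB.
rewrite !freeg_mul_gen; apply: gr_sub_iso.
pose sw n k (i : 'I_(n + k)) : 'I_(k + n) :=
  match fintype.split i with inl a => rshift k a | inr b => lshift n b end.
have swK n' k' : cancel (sw n' k') (sw k' n').
  move=> i; rewrite /sw; case: (split_ordP i) => j ->.
    by rewrite split_rshift.
  by rewrite split_lshift.
apply: (@schemic_iso_reindex _ _ _ _ (sw n k) (sw k n)) => // M MT v.
rewrite !form_prodP //=.
have -> : lsubmx (\row_j v 0 (sw k n j)) = rsubmx v.
  by apply/rowP=> j; rewrite !mxE /sw split_lshift.
have -> : rsubmx (\row_j v 0 (sw k n j)) = lsubmx v.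
  by apply/rowP=> j; rewrite !mxE /sw split_rshift.
by split=> -[].
Qed.

Lemma freeg_mulA a b c :
  freeg_mul a (freeg_mul b c) - freeg_mul (freeg_mul a b) c \in gr_sub.
Proof.
elim/freeg_gen_ind: a => [|a a' IHa IHa'|n p].
- by rewrite !freeg_mul0l subrr /gr_sub rpred0.
- rewrite !freeg_mulBl subrACA.
  exact: gr_subB.
elim/freeg_gen_ind: b => [|b b' IHb IHb'|k q].
- by rewrite !(freeg_mul0l, freeg_mul0r) subrr /gr_sub rpred0.
- rewrite !(freeg_mulBl, freeg_mulBr) subrACA.
  exact: gr_subB.
elim/freeg_gen_ind: c => [|c c' IHc IHc'|l r].
- by rewrite !freeg_mul0r subrr /gr_sub rpred0.
- rewrite !freeg_mulBr subrACA.
  exact: gr_subB.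
rewrite !freeg_mul_gen; apply: gr_sub_iso.
apply: (@schemic_iso_reindex _ _ _ _ (cast_ord (addnA n k l))
          (cast_ord (esym (addnA n k l)))).
- exact: cast_ordK.
- exact: cast_ordKV.
move=> M MT v; rewrite !form_prodP //=; set w := \row_j _.
have -> : lsubmx (lsubmx w) = lsubmx v.
  by apply/rowP=> i; rewrite !mxE; congr (v 0 _); apply: val_inj.
have -> : rsubmx (lsubmx w) = lsubmx (rsubmx v).
  by apply/rowP=> i; rewrite !mxE; congr (v 0 _); apply: val_inj.
have -> : rsubmx w = rsubmx (rsubmx v).
  by apply/rowP=> i; rewrite !mxE; congr (v 0 _); apply: val_inj; rewrite /= addnA.
tauto.
Qed.

Lemma freeg_mul1 a : freeg_mul freeg_one a - a \in gr_sub.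
Proof.
elim/freeg_gen_ind: a => [|a a' IHa IHa'|n p].
- by rewrite freeg_mul0r subrr /gr_sub rpred0.
- rewrite freeg_mulBr subrACA.
  exact: gr_subB.
rewrite freeg_mul_gen; apply: gr_sub_iso.
apply: (@schemic_iso_reindex (0 + n) n _ _ id id) => // M MT v.
rewrite form_prodP // form_trueP //=.
have -> : \row_j v 0 j = rsubmx v.
  by apply/rowP=> i; rewrite !mxE; congr (v 0 _); apply: val_inj.
tauto.
Qed.

Definition Gr := Quotient.quot gr_sub.
HB.instance Definition _ := ZmodQuotient.on Gr.
HB.instance Definition _ := GRing.Zmodule_isComPzRing.Build Gr
  (quot_mulA freeg_mulDl freeg_mulNl freeg_mulC freeg_mulA)
  (quot_mulC freeg_mulC)
  (quot_mul1 freeg_mulDl freeg_mulNl freeg_mulC freeg_mul1)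
  (quot_mulDl freeg_mulDl freeg_mulNl freeg_mulC).

Definition gr_class n (p : form T n) : Gr := \pi_Gr (gen p).

Lemma gr_class_mul n k (p : form T n) (q : form T k) :
  gr_class (form_prod p q) = gr_class p * gr_class q.
Proof.
rewrite /gr_class -freeg_mul_gen.
exact: (pi_quot_mul freeg_mulDl freeg_mulNl freeg_mulC).
Qed.

Lemma gr_class_true : gr_class (form_true T) = 1.
Proof. by []. Qed.

End Grothendieck.

Inductive boolean (A : Type) : Type :=
| BAtom of A
| BNot of boolean A
| BAnd of boolean A & boolean A
| BOr of boolean A & boolean A.

Fixpoint bool_sem (A : Type) (I : A -> Prop) (b : boolean A) : Prop :=
  match b with
  | BAtom a => I a
  | BNot b => ~ bool_sem I b
  | BAnd b c => bool_sem I b /\ bool_sem I c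
  | BOr b c => bool_sem I b \/ bool_sem I c
  end.

Fixpoint bool_map (A B : Type) (f : A -> B) (b : boolean A) : boolean B :=
  match b with
  | BAtom a => BAtom (f a)
  | BNot b => BNot (bool_map f b)
  | BAnd b c => BAnd (bool_map f b) (bool_map f c)
  | BOr b c => BOr (bool_map f b) (bool_map f c)
  end.

Lemma bool_sem_map (A B : Type) (f : A -> B) (I : A -> Prop) (J : B -> Prop) b :
  (forall a, J (f a) <-> I a) -> bool_sem J (bool_map f b) <-> bool_sem I b.
Proof.
move=> IJ; elim: b => [a|b IHb|b IHb c IHc|b IHb c IHc] //=.
- by rewrite IHb.
- by rewrite IHb IHc.
- by rewrite IHb IHc.
Qed.

(* Atomic formulae of the language of F-algebras amount to equations f = 0. *)
Definition qf n := boolean {mpoly F[n]}.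

Definition qf_set n (p : qf n) (M : model) : set 'rV[M]_n :=
  [set v | bool_sem (fun f => peval v f = 0) p].

Definition qf_rename n k (s : 'I_n -> 'I_k) : qf n -> qf k :=
  bool_map (rename s).

(* The formula (exists y) psi(x, y), x being the first n variables of psi. *)
Record pp n := PP {
  pp_bound : nat;
  pp_matrix : schemic (n + pp_bound)
}.

Definition pp_set n (p : pp n) (M : model) : set 'rV[M]_n :=
  [set v | exists w : 'rV[M]_(pp_bound p), schemic_set (pp_matrix p) (row_mx v w)].

Definition pp_rename n k (s : 'I_n -> 'I_k) (p : pp n) : pp k :=
  PP (map (rename (fun i => match fintype.split i with
                            | inl a => lshift (pp_bound p) (s a)
                            | inr b => rshift k b
                            end)) (pp_matrix p)).

Definition ppb n := boolean (pp n).

Definition ppb_set n (p : ppb n) (M : model) : set 'rV[M]_n :=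
  [set v | bool_sem (fun a : pp n => pp_set a v) p].

Definition ppb_rename n k (s : 'I_n -> 'I_k) : ppb n -> ppb k :=
  bool_map (pp_rename s).

Definition schemic_ppb n (s : schemic n) : ppb n :=
  BAtom (@PP n 0 (map (rename (@lshift n 0)) s)).

Arguments qf_set {n} p M _.
Arguments ppb_set {n} p M _.
Arguments schemic_set {n} s M _.

Lemma qf_renameP n k (s : 'I_n -> 'I_k) (p : qf n) (M : model) (v : 'rV[M]_k) :
  qf_set (qf_rename s p) M v <-> qf_set p M (\row_i v 0 (s i)).
Proof. by apply: bool_sem_map => f; rewrite peval_rename. Qed.

Lemma ppb_renameP n k (s : 'I_n -> 'I_k) (p : ppb n) (M : model) (v : 'rV[M]_k) :
  ppb_set (ppb_rename s p) M v <-> ppb_set p M (\row_i v 0 (s i)).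
Proof.
apply: bool_sem_map => -[m e]; rewrite /pp_set /=.
have E (w : 'rV[M]_m) : schemic_set (map (rename (fun i => match fintype.split i with
      | inl a => lshift m (s a) | inr b => rshift k b end)) e) M (row_mx v w)
    <-> schemic_set e M (row_mx (\row_i v 0 (s i)) w).
  rewrite schemic_rename; set x := \row_i _; set y := row_mx _ w.
  suff -> : x = y by [].
  apply/rowP=> i; rewrite mxE; case: (split_ordP i) => j ->.
    by rewrite !row_mxEl mxE.
  by rewrite !row_mxEr.
by split=> -[w /E ew]; exists w.
Qed.

Lemma schemic_ppbP n (s : schemic n) (M : model) (v : 'rV[M]_n) :
  ppb_set (schemic_ppb s) M v <-> schemic_set s M v.
Proof.
have E (w : 'rV[M]_0) : schemic_set (map (rename (@lshift n 0)) s) M (row_mx v w)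
    <-> schemic_set s M v.
  rewrite schemic_rename; set x := \row_i _; suff -> : x = v by [].
  by apply/rowP=> i; rewrite mxE row_mxEl.
by split=> [[w /E]//|sv]; exists 0; apply/E.
Qed.

(* The library has no structure joining falgType and comNzRingType. *)
Definition comalg (R : falgType F) of commutative (@GRing.mul R) : Type := R.

Section ComAlg.
Variables (R : falgType F) (mulC : commutative (@GRing.mul R)).
HB.instance Definition _ := GRing.NzRing.on (comalg mulC).
HB.instance Definition _ :=
  GRing.PzRing_hasCommutativeMul.Build (comalg mulC) mulC.
End ComAlg.

Definition alg_model (R : falgType F) (mulC : commutative (@GRing.mul R)) : model :=
  @Model (comalg mulC) (GRing.in_alg R : {rmorphism F -> R}).

Definition local (R : unitRingType) :=
  forall x y : R, x \isn't a GRing.unit -> y \isn't a GRing.unit ->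
    x + y \isn't a GRing.unit.

Variant artin : model -> Prop :=
  Artin (R : falgType F) (mulC : commutative (@GRing.mul R)) of local R :
    artin (alg_model mulC).

Definition extent n (P : set (ppb n)) (M : model) : set 'rV[M]_n :=
  [set v | exists2 p, P p & ppb_set p M v].

Arguments extent {n} P M _.

Definition is_formulary n (P : set (ppb n)) :=
  forall M, artin M -> exists2 p, P p & ppb_set p M = extent P M.

Record formulary n := Formulary {
  formulas :> set (ppb n);
  formularyP : is_formulary formulas
}.

Section FormularyOperations.
Variables n k : nat.

Definition ppb_prod (p : ppb n) (q : ppb k) : ppb (n + k) :=
  BAnd (ppb_rename (@lshift n k) p) (ppb_rename (@rshift n k) q).

Lemma ppb_prodP p q (M : model) (v : 'rV[M]_(n + k)) :
  ppb_set (ppb_prod p q) M v <-> ppb_set p M (lsubmx v) /\ ppb_set q M (rsubmx v).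
Proof.
have Lv : lsubmx v = \row_i v 0 (lshift k i) by apply/rowP=> i; rewrite !mxE.
have Rv : rsubmx v = \row_i v 0 (rshift n i) by apply/rowP=> i; rewrite !mxE.
have := conj (ppb_renameP (@lshift n k) p v) (ppb_renameP (@rshift n k) q v).
by rewrite -Lv -Rv /ppb_set /=; tauto.
Qed.

Definition fml_and (P Q : set (ppb n)) : set (ppb n) :=
  [set r | exists p q, [/\ P p, Q q & r = BAnd p q]].

(* The join of P and Q is given by the disjunctions: their extent is that of
   the union of P and Q, but the union need not contain a single formula with
   this extent (see extent_or and fml_orP). *)
Definition fml_or (P Q : set (ppb n)) : set (ppb n) :=
  [set r | exists p q, [/\ P p, Q q & r = BOr p q]].

Definition fml_prod (P : set (ppb n)) (Q : set (ppb k)) : set (ppb (n + k)) :=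
  [set r | exists p q, [/\ P p, Q q & r = ppb_prod p q]].

Lemma extent_and P Q M : extent (fml_and P Q) M = extent P M `&` extent Q M.
Proof.
apply/seteqP; split=> [v [_ [p [q [Pp Qq ->]]] [pv qv]]|v [[p Pp pv] [q Qq qv]]].
  by split; [exists p | exists q].
by exists (BAnd p q); [exists p, q | split].
Qed.

Lemma extent_setU (P Q : set (ppb n)) M :
  extent (P `|` Q) M = extent P M `|` extent Q M.
Proof.
apply/seteqP; split=> [v [p [Pp|Qp] pv]|v [[p Pp pv]|[p Qp pv]]].
- by left; exists p.
- by right; exists p.
- by exists p => //; left.
- by exists p => //; right.
Qed.

Lemma extent_or (P Q : formulary n) M : artin M ->
  extent (fml_or P Q) M = extent (P `|` Q) M.
Proof.
move=> AM; rewrite extent_setU; have [p0 Pp0 _] := formularyP P AM.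
have [q0 Qq0 _] := formularyP Q AM.
apply/seteqP; split=> [v [_ [p [q [Pp Qq ->]]] [pv|qv]]|v [[p Pp pv]|[q Qq qv]]].
- by left; exists p.
- by right; exists q.
- by exists (BOr p q0); [exists p, q0 | left].
- by exists (BOr p0 q); [exists p0, q | right].
Qed.

Lemma extent_prod (P : set (ppb n)) (Q : set (ppb k)) M :
  extent (fml_prod P Q) M =
    [set v | extent P M (lsubmx v) /\ extent Q M (rsubmx v)].
Proof.
apply/seteqP; split=> v.
  move=> [_ [p [q [Pp Qq ->]]] /ppb_prodP[pv qv]].
  by split; [exists p | exists q].
move=> [[p Pp pv] [q Qq qv]]; exists (ppb_prod p q); first by exists p, q.
exact/ppb_prodP.
Qed.

Lemma fml_andP (P Q : formulary n) : is_formulary (fml_and P Q).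
Proof.
move=> M AM; have [p Pp Ep] := formularyP P AM; have [q Qq Eq] := formularyP Q AM.
by exists (BAnd p q); [exists p, q | rewrite extent_and -Ep -Eq].
Qed.

Lemma fml_orP (P Q : formulary n) : is_formulary (fml_or P Q).
Proof.
move=> M AM; have [p Pp Ep] := formularyP P AM; have [q Qq Eq] := formularyP Q AM.
exists (BOr p q); first by exists p, q.
by rewrite extent_or // extent_setU -Ep -Eq.
Qed.

Lemma fml_prodP (P : formulary n) (Q : formulary k) :
  is_formulary (fml_prod P Q).
Proof.
move=> M AM; have [p Pp Ep] := formularyP P AM; have [q Qq Eq] := formularyP Q AM.
exists (ppb_prod p q); first by exists p, q.
by rewrite extent_prod -Ep -Eq; apply/seteqP; split=> v /ppb_prodP.
Qed.

Lemma fml1P (p : ppb n) : is_formulary [set p].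
Proof.
move=> M _; exists p => //; apply/seteqP; split=> [v pv|v [_ -> //]].
by exists p.
Qed.

End FormularyOperations.

Definition formulary1 n (p : ppb n) : formulary n := Formulary (fml1P p).

Lemma extent1 n (p : ppb n) M : extent [set p] M = ppb_set p M.
Proof.
by apply/seteqP; split=> [v [_ -> //]|v pv]; exists p.
Qed.

Definition pp_theory : theory.
refine (@Theory artin formulary (fun n P M => extent P M)
  (fun n P Q => Formulary (fml_andP P Q)) (fun n P Q => Formulary (fml_orP P Q))
  (fun n k P Q => Formulary (fml_prodP P Q)) (formulary1 (schemic_ppb [::]))
  _ _ _ _) => /=.
- by move=> n P Q M _; apply: extent_and.
- by move=> n P Q M AM; rewrite extent_or // extent_setU.
- by move=> n k P Q M _; apply: extent_prod.
- move=> M _; apply/seteqP; split=> // v _.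
  by rewrite extent1; apply/schemic_ppbP => f.
Defined.

Definition Gr_pp := Gr pp_theory.

Definition class_pp n (P : formulary n) : Gr_pp := @gr_class pp_theory n P.

(* For V = Spec B, with B = F[x] / (v), and Y the closed subscheme of V defined
   by I = (y) / (v), where (v) is contained in (y): the ideal of F[x] that
   defines B / I ^ k. *)
Definition jet_ideal n (v y : schemic n) (k : nat) : set {mpoly F[n]} :=
  ideal_gen ([set` v] `|` ideal_exp (ideal_gen [set` y]) k).

Definition total_jet n (v y : schemic n) : set (ppb n) :=
  [set p | exists s : schemic n,
     (exists2 k, (0 < k)%N & ideal_gen [set` s] = jet_ideal v y k)
     /\ p = schemic_ppb s].

Lemma schemic_ideal n (s : schemic n) (M : model) (v : 'rV[M]_n) :
  schemic_set s M v <-> forall f, ideal_gen [set` s] f -> peval v f = 0.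
Proof.
split=> [sv _ [t ts ->]|sv f fs]; last by apply/sv/ideal_gen_sub.
rewrite raddf_sum big_seq big1 //= => p /ts /sv e.
by rewrite rmorphM /= e mulr0.
Qed.

Section JetsFinitelyGenerated.
Variables (n : nat) (v y : schemic n).

Fixpoint power_gens k : schemic n :=
  if k is k'.+1 then [seq a * b | a <- y, b <- power_gens k'] else [:: 1].

Lemma power_gensP k :
  ideal_gen [set` power_gens k] = ideal_exp (ideal_gen [set` y]) k.
Proof.
apply/seteqP; split; apply: ideal_gen_least => f.
  move=> fk; apply: ideal_gen_sub.
  elim: k f fk => [|k IHk] f /=.
    by rewrite inE => /eqP ->; exists [::]; rewrite ?big_nil.
  move=> /allpairsP[[a b] /= [ay bk ->]].
  have [s [<- sy] ->] := IHk b bk; exists (a :: s); last by rewrite big_cons.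
  split=> // c; rewrite inE => /orP[/eqP ->|/sy //].
  exact: ideal_gen_sub.
move=> [s [<- sy] ->]; elim: s sy => [|a s IHs] sy /=.
  by rewrite big_nil; apply: ideal_gen_sub; rewrite /= inE.
have [t ty ->] : ideal_gen [set` y] a by apply: sy; rewrite inE eqxx.
have {IHs} : ideal_gen [set` power_gens (size s)] (\prod_(b <- s) b).
  by apply: IHs => b bs; apply: sy; rewrite inE bs orbT.
rewrite big_cons => -[u us ->]; rewrite mulr_suml big_seq.
apply: (@ideal_gen_sum _ _ _ t (mem t)) => p /ty py.
rewrite mulr_sumr big_seq; apply: (@ideal_gen_sum _ _ _ u (mem u)) => q /us qu.
rewrite mulrACA; apply/ideal_genM/ideal_gen_sub => /=.
by apply/allpairsP; exists (p.2, q.2).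
Qed.

Lemma jet_idealP k : ideal_gen [set` v ++ power_gens k] = jet_ideal v y k.
Proof.
apply/seteqP; split; apply: ideal_gen_least => f.
  rewrite /= mem_cat => /orP[fv|fk]; apply: ideal_gen_sub; first by left.
  by right; rewrite -power_gensP; apply: ideal_gen_sub.
move=> [fv|]; first by apply: ideal_gen_sub; rewrite /= mem_cat fv.
rewrite -power_gensP; apply: ideal_gen_least => {}f fk.
by apply: ideal_gen_sub; rewrite /= mem_cat fk orbT.
Qed.

End JetsFinitelyGenerated.

Section LocalNilpotent.
Variables (R : falgType F) (mulC : commutative (@GRing.mul R)) (locR : local R).

Fixpoint chain (q : R) (a : seq R) : seq R :=
  q :: (if a is b :: a' then chain (q * b) a' else [::]).

Lemma chain_mul q a x : x \in chain q a -> exists t, x = q * t.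
Proof.
elim: a q => [|b a IHa] q /=; rewrite inE.
  by move=> /eqP ->; exists 1; rewrite mulr1.
move=> /orP[/eqP ->|].
- by exists 1; rewrite mulr1.
- by move=> /IHa[t ->]; exists (b * t); rewrite mulrA.
Qed.

Lemma size_chain q a : size (chain q a) = (size a).+1.
Proof. by elim: a q => //= b a IHa q; rewrite IHa. Qed.

Lemma chain_free q a :
    (forall b, b \in a -> b \isn't a GRing.unit) ->
  q * \prod_(b <- a) b != 0 -> free (chain q a).
Proof.
elim: a q => [|b a IHa] q aN; first by rewrite big_nil mulr1 /= seq1_free.
rewrite big_cons mulrA => qa /=; rewrite free_cons; apply/andP; split; last first.
  by apply: IHa qa => c ca; apply: aN; rewrite inE ca orbT.
apply/negP => qb.
have /memv_imgP[t _] : q \in (amull (q * b) @: fullv)%VS.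
  apply: subvP qb; apply/span_subvP => x /chain_mul[t ->].
  have -> : q * b * t = amull (q * b) t by rewrite lfunE.
  by rewrite memv_img ?memvf.
rewrite lfunE /= => qE; move/eqP: qa; apply.
have bN : b * t \isn't a GRing.unit.
  rewrite unitrM_comm ?negb_and; last exact: mulC.
  by rewrite aN // inE eqxx.
have u : 1 - b * t \is a GRing.unit.
  apply: contraT => uN; have := locR uN bN.
  by rewrite subrK unitr1.
have e : q * (1 - b * t) = 0.
  by rewrite mulrBr mulr1 mulrA -qE subrr.
by rewrite -(mulrK u q) e !mul0r.
Qed.

Lemma local_nilpotent (a : seq R) :
    (forall b, b \in a -> b \isn't a GRing.unit) ->
  (\dim (fullv : {vspace R}) <= size a)%N -> \prod_(b <- a) b = 0.
Proof.
move=> aN le_a; apply/eqP/contraT => a0.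
have /eqP dimE : free (chain 1 a) by apply: chain_free; rewrite ?mul1r.
have := dimvS (subvf <<chain (1 : R) a>>).
by rewrite dimE size_chain leqNgt ltnS le_a.
Qed.

End LocalNilpotent.

Lemma total_jetP n (v y : schemic n) : is_formulary (total_jet v y).
Proof.
move=> M [R mulC locR]; set d := \dim (fullv : {vspace R}).
pose s := v ++ power_gens y d.+1.
have sJ : ideal_gen [set` s] = jet_ideal v y d.+1 by apply: jet_idealP.
have Js : total_jet v y (schemic_ppb s) by exists s; split=> //; exists d.+1.
exists (schemic_ppb s) => //; apply/seteqP; split=> [x sx|x].
  by exists (schemic_ppb s).
move=> [_ [t [[k k0 tJ] ->]] /schemic_ppbP tx]; apply/schemic_ppbP.
have {tJ} tJ f : jet_ideal v y k f -> peval x f = 0.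
  by rewrite -tJ => tf; have /schemic_ideal := tx; apply.
have yN f : ideal_gen [set` y] f -> (peval x f : R) \isn't a GRing.unit.
  move=> fy; apply/negP => /(unitrX k); have -> : (peval x f : R) ^+ k = 0.
    rewrite -[LHS](rmorphXn (peval x)); apply: tJ.
    apply: ideal_gen_sub; right; apply: ideal_gen_sub; exists (nseq k f).
      by split=> [|b /nseqP[-> _] //]; rewrite size_nseq.
    by rewrite big_nseq -/(iter _ _ _) iter_mulr_1.
  by rewrite unitr0.
apply/schemic_ideal => f; rewrite sJ => -[e es ->].
rewrite raddf_sum big_seq big1 //= => -[c g] /es /= gJ.
rewrite rmorphM /=; suff -> : peval x g = 0 by rewrite mulr0.
case: gJ => [gv|[r rs ->]].
  by apply: tJ; apply: ideal_gen_sub; left.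
rewrite raddf_sum big_seq big1 //= => -[c' h] /rs /= [a [sa ay] ->].
rewrite rmorphM rmorph_prod /=; suff -> : \prod_(b <- a) peval x b = 0.
  by rewrite mulr0.
rewrite -(big_map (peval x) predT id).
apply: (@local_nilpotent R mulC locR) => [_ /mapP[b /ay by_ ->]|].
  exact: yN.
by rewrite size_map sa leqnSn.
Qed.

Definition total_jet_formulary n (v y : schemic n) : formulary n :=
  Formulary (total_jetP v y).

Definition class_scheme n (s : schemic n) : Gr_pp :=
  class_pp (formulary1 (schemic_ppb s)).

Inductive jet_relation : set Gr_pp :=
| jet_rel n (v y : schemic n) of
    ideal_gen [set` v] `<=` ideal_gen [set` y] :
    jet_relation (class_pp (total_jet_formulary v y) - class_scheme y).

Definition jet_nideal : {pred Gr_pp} := in_ideal_gen jet_relation.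
HB.instance Definition _ := GRing.ZmodClosed.on jet_nideal.

Definition Gr_form := Quotient.quot jet_nideal.

Lemma jet_nideal0 (a b : Gr_pp) : a = b -> a - b \in jet_nideal.
Proof. by move=> ->; rewrite subrr /jet_nideal rpred0. Qed.

Lemma jet_nidealM (a b : Gr_pp) : a \in jet_nideal -> a * b \in jet_nideal.
Proof.
by move=> /in_ideal_genP aN; apply/in_ideal_genP; rewrite mulrC; apply: ideal_genM.
Qed.

HB.instance Definition _ := ZmodQuotient.on Gr_form.
HB.instance Definition _ := GRing.Zmodule_isComPzRing.Build Gr_form
  (quot_mulA (@mulrDl Gr_pp) jet_nidealM
     (fun a b => jet_nideal0 (mulrC a b)) (fun a b c => jet_nideal0 (mulrA a b c)))
  (quot_mulC (fun a b => jet_nideal0 (mulrC a b)))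
  (quot_mul1 (@mulrDl Gr_pp) jet_nidealM
     (fun a b => jet_nideal0 (mulrC a b)) (fun a => jet_nideal0 (mul1r a)))
  (quot_mulDl (@mulrDl Gr_pp) jet_nidealM
     (fun a b => jet_nideal0 (mulrC a b))).

(* The fields are arbitrary extensions of F. In Gr var_theory the relation gr_iso
   uses bijections whose graphs are given by polynomials over F. In positive
   characteristic these include the Frobenius x |-> x ^ p. *)
Variant acf : model -> Prop :=
  Acf (K : closedFieldType) (i : {rmorphism F -> K}) : acf (Model i).

Definition qf_true : qf 0 := BAtom 0.

Definition qf_prod n k (p : qf n) (q : qf k) : qf (n + k) :=
  BAnd (qf_rename (@lshift n k) p) (qf_rename (@rshift n k) q).

Lemma qf_prodP n k (p : qf n) (q : qf k) (M : model) (v : 'rV[M]_(n + k)) :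
  qf_set (qf_prod p q) M v <-> qf_set p M (lsubmx v) /\ qf_set q M (rsubmx v).
Proof.
have Lv : lsubmx v = \row_i v 0 (lshift k i) by apply/rowP=> i; rewrite !mxE.
have Rv : rsubmx v = \row_i v 0 (rshift n i) by apply/rowP=> i; rewrite !mxE.
have := conj (qf_renameP (@lshift n k) p v) (qf_renameP (@rshift n k) q v).
by rewrite -Lv -Rv /qf_set /=; tauto.
Qed.

Definition var_theory : theory.
refine (@Theory acf qf (fun n p M => qf_set p M) (fun n p q => BAnd p q)
  (fun n p q => BOr p q) qf_prod qf_true _ _ _ _) => //=.
- move=> n k p q M _; apply/seteqP; split=> v /qf_prodP //.
- by move=> M _; apply/seteqP; split=> // v _; rewrite /qf_set /= raddf0.
Defined.

Definition Gr_var := Gr var_theory.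

Definition class_var n (p : qf n) : Gr_var := @gr_class var_theory n p.

Definition base_model : model := @Model F idfun.

End Schemic.

Arguments schemic_set {F n} s M _.
Arguments form_set {F t n} p M _.
Arguments qf_set {F n} p M _.
Arguments ppb_set {F n} p M _.
Arguments extent {F n} P M _.

(* Main.v *)
Require Import Defs.
From HB Require Import structures.
From mathcomp Require Import all_boot all_order all_algebra all_field.
From mathcomp Require Import boolp classical_sets functions generic_quotient.
From mathcomp Require Import mpoly freeg.

Set Implicit Arguments.
Unset Strict Implicit.
Unset Printing Implicit Defensive.

Import GRing.Theory.

Local Open Scope classical_set_scope.
Local Open Scope quotient_scope.
Local Open Scope ring_scope.

(** The image of the class of a formulary P in Gr(F^var) only depends on the
    set P(F) of its F-rational points, so the point is that a quantifier free
    formula is determined up to equivalence by its F-points, and that the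
    schemic isomorphisms survive the passage from F to a larger algebraically
    closed field K.  Both are cases of the model completeness of algebraically
    closed fields, which is obtained here from quantifier elimination that is
    uniform in K: the projection of a set defined by a quantifier free formula
    over F is defined in all algebraically closed extensions of F by one
    and the same quantifier free formula (qf_definable_ex).  As formulae
    without variables have the same truth value in K and in F, a universal
    sentence with a definable matrix that holds in F holds in K
    (qf_definable_transfer).

    Quantifier elimination eliminates one variable at a time.  A finite system
    f = 0, g <> 0 in one variable over F[x] is reduced, by Euclidean
    pseudo-division and by case distinctions on the vanishing of leading
    coefficients, to a single equation f = 0 whose leading coefficient does not
    vanish; a solution then exists exactly if f does not divide g ^ deg f,
    which is a condition on the coefficients of a pseudo-remainder.

    Since F itself is an Artinian local F-algebra, P(F) is defined by a formula
    in the Boolean closure of the pp-formulae, hence by a quantifier free one.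
    Its class in Gr(F^var) is invariant under equivalence of formularies, it is
    additive and multiplicative because (.)(F) commutes with the Boolean
    operations and with products, and it is invariant under schemic
    isomorphisms: that a schemic formula theta is the graph of a bijection, with
    inverse given by theta', is expressed by first-order sentences (bij_graph),
    which go from F to K (bij_graph_transfer), so that the same theta and
    theta' serve in K.  This gives a ring homomorphism on Gr^oo(F^pp).  It kills
    [J_Y V] - [Y], as the infinitesimal neighbourhoods of Y in V have the same
    F-points as Y (total_jet_points), and so factors through Gr(F^form). *)

(** * Quantifier elimination, uniformly in the algebraically closed extensions of F *)

Lemma rmorph_mmap n (R : nzRingType) (S S' : comNzRingType)
    (g : {rmorphism S -> S'}) (h : R -> S) (h' : R -> S')
    (x : 'I_n -> S) (x' : 'I_n -> S') (p : {mpoly R[n]}) :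
  (forall c, g (h c) = h' c) -> (forall i, g (x i) = x' i) ->
  g (mmap h x p) = mmap h' x' p.
Proof.
move=> gh gx; rewrite /mmap rmorph_sum; apply: eq_bigr => m _.
rewrite rmorphM gh /mmap1 rmorph_prod; congr (_ * _).
by apply: eq_bigr => i _; rewrite rmorphXn gx.
Qed.

(** The polynomial f splits into deg f linear factors, and if each of them
    divides g, then their product divides g ^ deg f. *)
Lemma exists_root_nonroot_dvdp (K : closedFieldType) (f g : {poly K}) : f != 0 ->
  (exists w, f.[w] = 0 /\ g.[w] <> 0) <-> ~~ (f %| g ^+ (size f).-1).
Proof.
move=> f0; have [r fE] := closed_field_poly_normal f.
have c0 : lead_coef f != 0 by rewrite lead_coef_eq0.
split=> [[w [fw gw]]|ndvd].
  apply/negP => /root_dvdp/(_ (introT eqP fw)); rewrite /root horner_exp.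
  by rewrite expf_eq0 => /andP[_ /eqP].
apply: contrapT => /forallNP nsol; move/negP: ndvd; apply.
rewrite fE dvdpZl // size_scale // size_prod_XsubC /=.
have {fE} : forall w, w \in r -> root g w.
  move=> w wr; apply/rootP; apply: contrapT => gw; apply: (nsol w); split=> //.
  by rewrite fE; apply/rootP; rewrite rootZ // root_prod_XsubC.
elim: r => [|z r IHr] gr; first by rewrite big_nil dvd1p.
rewrite big_cons exprS dvdp_mul ?dvdp_XsubCl ?gr ?mem_head //.
by apply: IHr => w wr; apply: gr; rewrite inE wr orbT.
Qed.

Section UniformQE.
Variable F : fieldType.
Implicit Types (M : model F) (n k : nat).

(** A set of points in every F-algebra at once.  Definability by a formula is
    only required to hold in the algebraically closed fields, but there for one
    formula with coefficients in F: this is what makes the elimination below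
    uniform. *)
Definition uniform_set n := forall M, set 'rV[M]_n.

Definition qf_definable n (S : uniform_set n) :=
  exists p : qf F n, forall M, acf M -> forall v, qf_set p M v <-> S M v.

Section BooleanOperations.
Variable n : nat.
Implicit Types S T : uniform_set n.

Lemma qf_definable_ext S T :
    (forall M, acf M -> forall v, S M v <-> T M v) ->
  qf_definable S -> qf_definable T.
Proof.
by move=> ST [p pS]; exists p => M MK v; rewrite pS // ST.
Qed.

Lemma qf_definable_qf (p : qf F n) : qf_definable (fun M => qf_set p M).
Proof. by exists p. Qed.

Lemma qf_definable_eq0 (f : {mpoly F[n]}) :
  qf_definable (fun M v => peval v f = 0).
Proof. by exists (BAtom f). Qed.

Lemma qf_definable_not S : qf_definable S -> qf_definable (fun M v => ~ S M v).
Proof. by move=> [p pS]; exists (BNot p) => M MK v; rewrite -(pS M MK v). Qed.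

Lemma qf_definable_and S T : qf_definable S -> qf_definable T ->
  qf_definable (fun M v => S M v /\ T M v).
Proof.
move=> [p pS] [q qT]; exists (BAnd p q) => M MK v.
by rewrite -(pS M MK v) -(qT M MK v).
Qed.

Lemma qf_definable_or S T : qf_definable S -> qf_definable T ->
  qf_definable (fun M v => S M v \/ T M v).
Proof.
move=> [p pS] [q qT]; exists (BOr p q) => M MK v.
by rewrite -(pS M MK v) -(qT M MK v).
Qed.

Lemma qf_definable_imp S T : qf_definable S -> qf_definable T ->
  qf_definable (fun M v => S M v -> T M v).
Proof.
move=> [p pS] [q qT]; exists (BOr (BNot p) q) => M MK v.
rewrite -(pS M MK v) -(qT M MK v) /qf_set /=.
by have := EM (bool_sem (fun f => peval v f = 0) p); tauto.
Qed.

Lemma qf_definable_iff S T : qf_definable S -> qf_definable T ->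
  qf_definable (fun M v => S M v <-> T M v).
Proof.
by move=> dS dT; apply: qf_definable_and; apply: qf_definable_imp.
Qed.

Lemma qf_definable_cst (P : Prop) : qf_definable (fun M (_ : 'rV[M]_n) => P).
Proof.
have [Pt|Pf] := EM P; [exists (BAtom 0)|exists (BNot (BAtom 0))] => M _ v;
  by rewrite /qf_set /= raddf0; tauto.
Qed.

Lemma qf_definable_all (I : eqType) (r : seq I) (S : I -> uniform_set n) :
    (forall i, qf_definable (S i)) ->
  qf_definable (fun M v => forall i, i \in r -> S i M v).
Proof.
move=> dS; elim: r => [|i r IHr].
  by apply: qf_definable_ext (qf_definable_cst True).
apply: qf_definable_ext (qf_definable_and (dS i) IHr) => M MK v.
split=> [[Si Sr] j|Sr]; first by rewrite inE => /orP[/eqP ->|/Sr].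
by split=> [|j jr]; apply: Sr; rewrite inE ?eqxx ?jr ?orbT.
Qed.

Lemma qf_definable_has (I : eqType) (r : seq I) (S : I -> uniform_set n) :
    (forall i, qf_definable (S i)) ->
  qf_definable (fun M v => exists2 i, i \in r & S i M v).
Proof.
move=> dS; have dN i := qf_definable_not (dS i).
apply: qf_definable_ext (qf_definable_not (qf_definable_all r dN)) => M MK v.
split=> [/existsNP[i /not_implyP[ir /contrapT Si]]|[i ir Si] Sr].
  by exists i.
exact: Sr Si.
Qed.

End BooleanOperations.

Lemma qf_definable_rename n k (s : 'I_n -> 'I_k) (S : uniform_set n) :
  qf_definable S -> qf_definable (fun M v => S M (\row_i v 0 (s i))).
Proof.
move=> [p pS]; exists (qf_rename s p) => M MK v.
by rewrite qf_renameP pS.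
Qed.

Section OneVariable.
Variable n : nat.
Implicit Types f g h : {poly {mpoly F[n]}}.

(** The polynomials in one variable over F[x] are families of polynomials in one
    variable, parametrized by the points v. *)
Definition fiber M (v : 'rV[M]_n) f : {poly M} := map_poly (peval v) f.

HB.instance Definition _ M (v : 'rV[M]_n) :=
  GRing.RMorphism.copy (fiber v) (map_poly (peval v)).

Lemma coef_fiber M (v : 'rV[M]_n) f i : (fiber v f)`_i = peval v f`_i.
Proof. by rewrite /fiber coef_map. Qed.

Lemma fiber0P M (v : 'rV[M]_n) f :
  fiber v f = 0 <-> forall c, c \in (f : seq _) -> peval v c = 0.
Proof.
split=> [f0 c /(nthP 0)[i _ <-]|f0]; first by rewrite -coef_fiber f0 coef0.
apply/polyP=> i; rewrite coef0 coef_fiber.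
have [lt_i|le_i] := ltnP i (size f); first by apply/f0/mem_nth.
by rewrite nth_default // raddf0.
Qed.

Lemma qf_definable_fiber0 f : qf_definable (fun M v => fiber v f = 0).
Proof.
apply: qf_definable_ext (qf_definable_all f (@qf_definable_eq0 n)) => M MK v.
by rewrite fiber0P.
Qed.

(** Pseudo-division takes place over F[x], before specialization to v, so that
    quotient and remainder do not depend on the field. *)
Lemma fiber_divp_eq M (v : 'rV[M]_n) f h :
  peval v (lead_coef h) ^+ scalp f h *: fiber v f =
    fiber v (f %/ h) * fiber v h + fiber v (f %% h).
Proof.
have /(congr1 (fiber v)) := Pdiv.Idomain.divp_eq f h.
by rewrite rmorphD rmorphM /= -!mul_polyC rmorphM /= /fiber map_polyC /= rmorphXn.
Qed.

Lemma fiber_take M (v : 'rV[M]_n) f :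
  peval v (lead_coef f) = 0 -> fiber v (take_poly (size f).-1 f) = fiber v f.
Proof.
move=> c0; apply/polyP=> i; rewrite !coef_fiber coef_take_poly.
case: ltnP => // le_i; rewrite raddf0.
have [e|ne] := eqVneq i (size f).-1; first by rewrite e -lead_coefE c0.
rewrite nth_default ?raddf0 //; case: (size f) le_i ne => //= d.
by rewrite leq_eqVlt eq_sym => /orP[->|].
Qed.

Definition solvable_fiber (fs : seq {poly {mpoly F[n]}}) g : uniform_set n :=
  fun M v => exists w : M,
    (forall f, f \in fs -> (fiber v f).[w] = 0) /\ (fiber v g).[w] <> 0.

Lemma fiber_modp M (v : 'rV[M]_n) f h (w : M) :
    acf M -> peval v (lead_coef h) <> 0 -> (fiber v h).[w] = 0 ->
  (fiber v (f %% h)).[w] = 0 <-> (fiber v f).[w] = 0.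
Proof.
move=> MK; case: MK v w => K i v w c0 hw.
have /(congr1 (fun p => p.[w])) := fiber_divp_eq v f h.
rewrite hornerZ hornerD hornerM hw mulr0 add0r => <-.
split=> [/eqP|->]; last by rewrite mulr0.
by rewrite (@mulf_eq0 K) (@expf_eq0 K) => /orP[/andP[_ /eqP]|/eqP].
Qed.

Lemma size_fiber M (v : 'rV[M]_n) h : peval v (lead_coef h) <> 0 ->
  size (fiber v h) = size h.
Proof. by move=> /eqP c0; rewrite /fiber /map_poly size_poly_eq. Qed.

(** By exists_root_nonroot_dvdp, the left-hand side says that the fiber of h does
    not divide that of f ^ deg h.  This is read off the pseudo-remainder, whose
    fiber still has smaller degree than that of h. *)
Lemma exists_fiber_root_modp M (v : 'rV[M]_n) (f h : {poly {mpoly F[n]}}) :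
    acf M -> peval v (lead_coef h) <> 0 ->
  (exists w, (fiber v h).[w] = 0 /\ (fiber v f).[w] <> 0) <->
    fiber v ((f ^+ (size h).-1) %% h) <> 0.
Proof.
move=> MK; case: MK v => K i v c0.
have sz := size_fiber c0.
set p := fiber v h; have p0 : p != 0.
  rewrite -size_poly_eq0 sz size_poly_eq0; apply: contra_notN c0 => /eqP ->.
  by rewrite lead_coef0 raddf0.
rewrite (@exists_root_nonroot_dvdp K) // sz.
have /(congr1 (fun q => p %| q)) := fiber_divp_eq v (f ^+ (size h).-1) h.
rewrite dvdpZr ?(@expf_neq0 K) //; last exact/eqP.
rewrite dvdp_addr ?dvdp_mull // rmorphXn /= => ->.
split=> [ndvd r0|/eqP r0]; first by move/negP: ndvd; rewrite r0 dvdp0.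
rewrite gtNdvdp // sz (leq_ltn_trans (size_poly _ _)) //.
rewrite ltn_modp; apply: contra_notN c0 => /eqP ->.
by rewrite lead_coef0 raddf0.
Qed.

(** Specialization to v commutes with the degree only where the leading
    coefficient does not vanish; where it vanishes, the leading term can be
    dropped. *)
Lemma qf_definable_lead_split h (S S0 S1 : uniform_set n) :
    qf_definable S0 -> qf_definable S1 ->
    (forall M, acf M -> forall v : 'rV[M]_n,
       peval v (lead_coef h) = 0 -> S M v <-> S0 M v) ->
    (forall M, acf M -> forall v : 'rV[M]_n,
       peval v (lead_coef h) <> 0 -> S M v <-> S1 M v) ->
  qf_definable S.
Proof.
move=> dS0 dS1 SS0 SS1; have dc := qf_definable_eq0 (lead_coef h).
apply: qf_definable_ext (qf_definable_or (qf_definable_and dc dS0)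
  (qf_definable_and (qf_definable_not dc) dS1)) => M MK v.
have [c0|c0] := EM (peval v (lead_coef h) = 0).
  by rewrite SS0 //; tauto.
by rewrite SS1 //; tauto.
Qed.

(** The induction on the sum of the sizes, in which each polynomial counts one
    more than its size in order that zero polynomials can be discarded, is the
    Euclidean algorithm. *)
Lemma qf_definable_solvable_fiber fs g : qf_definable (solvable_fiber fs g).
Proof.
have [m] := ubnP (\sum_(f <- fs) (size f).+1)%N.
elim: m fs => // m IHm; case=> [|f [|h fs]] le_fs.
- (* An algebraically closed field is infinite, so g only has to be nonzero. *)
  apply: qf_definable_ext (qf_definable_not (qf_definable_fiber0 g)) => M MK v.
  case: MK v => K i v; split=> [/eqP/(@closed_nonrootP K)[w /rootP gw]|[w [_ gw]] g0].
    by exists w; split.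
  by apply: gw; rewrite g0 horner0.
- rewrite big_seq1 ltnS in le_fs.
  have [f0|f0] := eqVneq f 0.
    apply: qf_definable_ext (IHm [::] _) => [M MK v|]; last first.
      by rewrite big_nil (leq_trans _ le_fs).
    split=> -[w [fw gw]]; exists w; split=> // h; rewrite inE => /eqP ->.
    by rewrite f0 raddf0 horner0.
  apply: (@qf_definable_lead_split f _ (solvable_fiber [:: take_poly (size f).-1 f] g)
    (fun M v => fiber v ((g ^+ (size f).-1) %% f) <> 0)).
  + apply: IHm; rewrite big_seq1 (leq_trans _ le_fs) // ltnS.
    by rewrite (leq_ltn_trans (size_take_poly _ _)) // prednK ?size_poly_gt0.
  + exact/qf_definable_not/qf_definable_fiber0.
  + move=> M MK v c0; split=> -[w [fw gw]]; exists w; split=> // h.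
      by rewrite inE => /eqP ->; rewrite fiber_take // fw ?mem_head.
    by rewrite inE => /eqP ->; rewrite -fiber_take // fw ?mem_head.
  + move=> M MK v c0; rewrite -exists_fiber_root_modp //.
    split=> -[w [fw gw]]; exists w; split=> //; first by rewrite fw ?mem_head.
    by move=> h; rewrite inE => /eqP ->.
wlog le_fh : f h le_fs / (size f <= size h)%N => [wlogfh|].
  have [|/ltnW le_hf] := leqP (size f) (size h); first exact: wlogfh.
  apply: qf_definable_ext (wlogfh h f _ le_hf) => [M MK v|]; last first.
    by move: le_fs; rewrite !big_cons addnCA.
  by split=> -[w [fw gw]]; exists w; split=> // p;
    rewrite !inE => p_in; apply: fw; rewrite !inE orbCA.
move: le_fs; rewrite !big_cons ltnS => le_fs.
have [f0|f0] := eqVneq f 0.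
  apply: qf_definable_ext (IHm (h :: fs) _) => [M MK v|]; last first.
    by rewrite big_cons (leq_trans _ le_fs) // addSn ltnS leq_addl.
  split=> -[w [fw gw]]; exists w; split=> // p p_in; last first.
    by apply: fw; rewrite inE p_in orbT.
  have [->|pf] := eqVneq p f; first by rewrite f0 raddf0 horner0.
  by apply: fw; move: p_in; rewrite inE (negPf pf).
apply: (@qf_definable_lead_split f _
  (solvable_fiber [:: take_poly (size f).-1 f, h & fs] g)
  (solvable_fiber [:: f, h %% f & fs] g)).
- apply: IHm; rewrite !big_cons (leq_trans _ le_fs) // ltn_add2r ltnS.
  by rewrite (leq_ltn_trans (size_take_poly _ _)) // prednK ?size_poly_gt0.
- apply: IHm; rewrite !big_cons (leq_trans _ le_fs) // ltn_add2l ltn_add2r ltnS.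
  by rewrite (leq_trans _ le_fh) // ltn_modp.
- move=> M MK v c0; split=> -[w [fw gw]]; exists w; split=> // p.
    rewrite inE => /orP[/eqP ->|p_in]; last by apply: fw; rewrite inE p_in orbT.
    by rewrite fiber_take // fw ?mem_head.
  rewrite inE => /orP[/eqP ->|p_in]; last by apply: fw; rewrite inE p_in orbT.
  by rewrite -fiber_take // fw ?mem_head.
- move=> M MK v c0; split=> -[w [fw gw]]; exists w; split=> // p;
    have f_w : (fiber v f).[w] = 0 by rewrite fw ?mem_head.
    rewrite !inE => /or3P[/eqP -> //|/eqP ->|p_in].
      by rewrite fiber_modp // fw // !inE eqxx orbT.
    by apply: fw; rewrite !inE p_in !orbT.
  rewrite !inE => /or3P[/eqP -> //|/eqP ->|p_in].
    by rewrite -(fiber_modp h MK c0 f_w) // fw // !inE eqxx orbT.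
  by apply: fw; rewrite !inE p_in !orbT.
Qed.

Definition last_var_poly (p : {mpoly F[n + 1]}) : {poly {mpoly F[n]}} :=
  mmap (fun c => c%:MP%:P)
    (fun i => if fintype.split i is inl j then ('X_j)%:P else 'X) p.

Lemma horner_last_var_poly M (v : 'rV[M]_n) (w : M) p :
  (fiber v (last_var_poly p)).[w] = peval (row_mx v w%:M) p.
Proof.
rewrite /last_var_poly -[LHS]/((horner_eval w \o fiber v) _).
rewrite /peval; apply: rmorph_mmap => [c|i] /=.
  by rewrite /fiber map_polyC /= /horner_eval hornerC /peval mmapC.
case: (split_ordP i) => j ->.
  by rewrite row_mxEl /fiber map_polyC /= /horner_eval hornerC pevalX.
by rewrite row_mxEr /fiber map_polyX /horner_eval hornerX ord1 mxE.
Qed.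

End OneVariable.

Section DisjunctiveForm.
Variable n : nat.
Local Notation clause := (seq {mpoly F[n]} * {mpoly F[n]})%type.

(** In an integral domain, a conjunction of inequations amounts to one for their
    product. *)
Definition clause_set (c : clause) : uniform_set n := fun M v =>
  schemic_set c.1 M v /\ peval v c.2 <> 0.

Definition has_dnf (S : uniform_set n) := exists cs : seq clause,
  forall M, acf M -> forall v, S M v <-> exists2 c, c \in cs & clause_set c v.

Lemma has_dnf_or (S T : uniform_set n) : has_dnf S -> has_dnf T ->
  has_dnf (fun M v => S M v \/ T M v).
Proof.
move=> [cs csS] [ds dsT]; exists (cs ++ ds) => M MK v; rewrite csS // dsT //.
split=> [[[c c_in cv]|[c c_in cv]]|[c]].
- by exists c => //; rewrite mem_cat c_in.
- by exists c => //; rewrite mem_cat c_in orbT.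
- by rewrite mem_cat => /orP[c_in|c_in] cv; [left|right]; exists c.
Qed.

Lemma has_dnf_and (S T : uniform_set n) : has_dnf S -> has_dnf T ->
  has_dnf (fun M v => S M v /\ T M v).
Proof.
move=> [cs csS] [ds dsT].
exists [seq (c.1 ++ d.1, c.2 * d.2) | c <- cs, d <- ds] => M MK v.
rewrite csS // dsT // /clause_set.
have mulN0 (f g : {mpoly F[n]}) :
    peval v (f * g) <> 0 <-> peval v f <> 0 /\ peval v g <> 0.
  rewrite rmorphM /=; case: MK v => K i v; split=> [fg|[/eqP f0 /eqP g0]].
    by split=> e; apply: fg; rewrite e ?mul0r ?mulr0.
  by apply/eqP; rewrite (@mulf_neq0 K).
split=> [[[c c_in [c1 c2]] [d d_in [d1 d2]]]|[_ /allpairsP[[c d] /= [c_in d_in ->]]]].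
  exists (c.1 ++ d.1, c.2 * d.2); last by rewrite schemic_cat mulN0.
  by apply/allpairsP; exists (c, d).
rewrite schemic_cat mulN0 => -[[c1 d1] [c2 d2]].
by split; [exists c|exists d].
Qed.

(** The complement is carried along because negation exchanges conjunctions and
    disjunctions. *)
Lemma qf_has_dnf (p : qf F n) :
  has_dnf (fun M => qf_set p M) /\ has_dnf (fun M => ~` qf_set p M).
Proof.
elim: p => [f|p [dp dNp]|p [dp dNp] q [dq dNq]|p [dp dNp] q [dq dNq]].
- split; [exists [:: ([:: f], 1)]|exists [:: ([::], f)]] => M MK v.
    split=> [fv|[c]]; last by rewrite inE => /eqP -> [/(_ f (mem_head _ _))].
    exists ([:: f], 1); rewrite ?mem_head //; split=> [g|].
      by rewrite inE => /eqP ->.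
    by rewrite rmorph1; apply/eqP/oner_neq0.
  split=> [fv|[c]]; last by rewrite inE => /eqP -> [].
  by exists ([::], f); rewrite ?mem_head.
- split=> //; move: dp => [cs csP]; exists cs => M MK v.
  by rewrite -csP //; split=> [/contrapT|pv /(_ pv)].
- split; first exact: has_dnf_and.
  have [cs csP] := has_dnf_or dNp dNq; exists cs => M MK v; rewrite -csP //.
  by rewrite /qf_set /=; have := EM (bool_sem (fun f => peval v f = 0) p); tauto.
- split; first exact: has_dnf_or.
  have [cs csP] := has_dnf_and dNp dNq; exists cs => M MK v; rewrite -csP //.
  by rewrite /qf_set /=; tauto.
Qed.

End DisjunctiveForm.

Lemma qf_definable_ex1 n (S : uniform_set (n + 1)) : qf_definable S ->
  qf_definable (fun M (v : 'rV[M]_n) => exists w : M, S M (row_mx v w%:M)).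
Proof.
move=> [p pS]; have [[cs csP] _] := qf_has_dnf p.
have dc := qf_definable_has cs (fun c => qf_definable_solvable_fiber
  [seq last_var_poly f | f <- c.1] (last_var_poly c.2)).
apply: qf_definable_ext dc => M MK v; split.
  move=> [c c_in [w [fw gw]]]; exists w; rewrite -pS // csP //; exists c => //.
  rewrite horner_last_var_poly in gw; split=> // f f_in.
  by rewrite -horner_last_var_poly fw ?map_f.
move=> [w]; rewrite -pS // csP // => -[c c_in [fw gw]].
exists c => //; exists w; split=> [_ /mapP[f f_in ->]|];
  by rewrite horner_last_var_poly // fw.
Qed.

Lemma qf_definable_ex n k (S : uniform_set (n + k)) : qf_definable S ->
  qf_definable (fun M (v : 'rV[M]_n) => exists w : 'rV[M]_k, S M (row_mx v w)).
Proof.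
elim: k n S => [|k IHk] n S dS.
  apply: qf_definable_ext (qf_definable_rename (cast_ord (addn0 n)) dS) => M MK v.
  have E (w : 'rV[M]_0) : row_mx v w = \row_i v 0 (cast_ord (addn0 n) i).
    apply/rowP=> i; rewrite mxE; case: (split_ordP i) => [j ->|[]//].
    by rewrite row_mxEl; congr (v 0 _); apply: val_inj.
  by split=> [Sv|[w]]; [exists 0; rewrite E|rewrite E].
have dS' := qf_definable_ex1 (IHk _ _
  (qf_definable_rename (cast_ord (addnA n 1 k)) dS)).
apply: qf_definable_ext dS' => M MK v.
have E (a : M) (w : 'rV[M]_k) :
    \row_i row_mx (row_mx v a%:M) w 0 (cast_ord (addnA n 1 k) i) =
      row_mx v (row_mx a%:M w).
  apply/rowP=> i; rewrite mxE; case: (split_ordP i) => j ->.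
    have -> : cast_ord (addnA n 1 k) (lshift (1 + k) j) =
      lshift k (lshift 1 j) by exact: val_inj.
    by rewrite !row_mxEl.
  case: (split_ordP j) => l ->.
    have -> : cast_ord (addnA n 1 k) (rshift n (lshift k l)) =
      lshift k (rshift n l) by exact: val_inj.
    by rewrite row_mxEl !row_mxEr row_mxEl.
  have -> : cast_ord (addnA n 1 k) (rshift n (rshift 1 l)) = rshift (n + 1) l.
    by apply: val_inj; rewrite /= addnA.
  by rewrite !row_mxEr.
split=> [[a [w]]|[w Sv]]; first by rewrite E => Sv; exists (row_mx a%:M w).
pose u : 'rV[M]_(1 + k) := w; exists (lsubmx u 0 0), (rsubmx u).
by rewrite E -mx11_scalar hsubmxK.
Qed.

End UniformQE.

(** * The transfer of first-order sentences from F to its extensions *)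

Section FirstOrder.
Variable F : fieldType.
Implicit Types (M : model F) (n k : nat).

Lemma qf_definable_schemic n (s : schemic F n) :
  qf_definable (fun M => schemic_set s M).
Proof.
exact: (@qf_definable_all F n _ s (fun f M v => peval v f = 0) (@qf_definable_eq0 F n)).
Qed.

Lemma qf_definable_ppb n (p : ppb F n) : qf_definable (fun M => ppb_set p M).
Proof.
elim: p => [a|p dp|p dp q dq|p dp q dq].
- exact: (qf_definable_ex (qf_definable_schemic (pp_matrix a))).
- exact: qf_definable_not dp.
- exact: qf_definable_and dp dq.
- exact: qf_definable_or dp dq.
Qed.

(** The maps that pick coordinates of the point v: they take the place of the
    variables of a first-order formula whose context is v, so that definability
    of such a formula is proved by following its structure. *)
Definition selection N n (t : forall M, 'rV[M]_N -> 'rV[M]_n) :=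
  exists s : 'I_n -> 'I_N, forall M v, t M v = \row_i v 0 (s i).

Lemma selection_id n : selection (fun M (v : 'rV[M]_n) => v).
Proof. by exists id => M v; apply/rowP=> i; rewrite mxE. Qed.

Lemma selectionl N n k (t : forall M, 'rV[M]_N -> 'rV[M]_(n + k)) :
  selection t -> selection (fun M v => lsubmx (t M v)).
Proof.
move=> [s ts]; exists (s \o lshift k) => M v.
by rewrite ts; apply/rowP=> i; rewrite !mxE.
Qed.

Lemma selectionr N n k (t : forall M, 'rV[M]_N -> 'rV[M]_(n + k)) :
  selection t -> selection (fun M v => rsubmx (t M v)).
Proof.
move=> [s ts]; exists (s \o @rshift n k) => M v.
by rewrite ts; apply/rowP=> i; rewrite !mxE.
Qed.

Lemma selection_row_mx N n k (t : forall M, 'rV[M]_N -> 'rV[M]_n)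
    (t' : forall M, 'rV[M]_N -> 'rV[M]_k) :
  selection t -> selection t' -> selection (fun M v => row_mx (t M v) (t' M v)).
Proof.
move=> [s ts] [s' ts'].
exists (fun i => match fintype.split i with inl j => s j | inr j => s' j end) => M v.
rewrite ts ts'; apply/rowP=> i; rewrite [RHS]mxE; case: (split_ordP i) => j ->.
  by rewrite row_mxEl mxE.
by rewrite row_mxEr mxE.
Qed.

Lemma qf_definable_sel N n (S : uniform_set F n) (t : forall M, 'rV[M]_N -> 'rV[M]_n) :
  selection t -> qf_definable S -> qf_definable (fun M v => S M (t M v)).
Proof.
move=> [s ts] /(qf_definable_rename s); apply: qf_definable_ext => M _ v.
by rewrite ts.
Qed.

Lemma qf_definable_eq N n (t t' : forall M, 'rV[M]_N -> 'rV[M]_n) :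
  selection t -> selection t' -> qf_definable (fun M v => t M v = t' M v).
Proof.
move=> [s ts] [s' ts'].
apply: qf_definable_ext (qf_definable_schemic (var_eqs F s s')) => M _ v.
rewrite var_eqsP ts ts'; split=> [e|/rowP e i].
  by apply/rowP=> i; rewrite !mxE.
by have := e i; rewrite !mxE.
Qed.

(** G is the graph of a bijection from X to Y and G' that of its inverse, without
    mention of the bijection, so that for definable X, Y, G and G' each of the
    clauses is a first-order sentence. *)
Definition bij_graph (A B : Type) (X : set A) (Y : set B)
    (G : A -> B -> Prop) (G' : B -> A -> Prop) :=
  [/\ forall x, X x -> exists y, Y y /\ G x y,
      forall x y y', X x -> G x y -> G x y' -> y = y',
      forall y, Y y -> exists x, X x /\ G x y,
      forall x x' y, X x -> X x' -> G x y -> G x' y -> x = x'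
    & forall y x, Y y -> G' y x <-> X x /\ G x y].

Lemma bij_graphP (A B : Type) (X : set A) (Y : set B) (b : B)
    (G : A -> B -> Prop) (G' : B -> A -> Prop) :
  bij_graph X Y G G' <-> exists f : A -> B,
    [/\ set_bij X Y f, forall x y, X x -> (G x y <-> y = f x)
      & forall y x, Y y -> (G' y x <-> X x /\ f x = y)].
Proof.
split=> [[Gtot Gfun Gsurj Ginj G'P]|[f [[fim finj fsurj] fP f'P]]].
  have /choice[f fG] : forall x, exists y, X x -> Y y /\ G x y.
    by move=> x; have [/Gtot[y Gxy]|nX] := EM (X x); [exists y|exists b].
  have fP x y : X x -> (G x y <-> y = f x).
    move=> Xx; have [_ Gf] := fG x Xx; split=> [Gxy|-> //].
    exact: Gfun Xx Gxy Gf.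
  exists f; split=> // [|y x Yy].
    split=> [x /fG[]//|x x'|y /Gsurj[x [Xx /(fP _ _ Xx) ->]]]; last by exists x.
    rewrite !inE => Xx Xx' e; apply: (Ginj _ _ (f x)) => //; apply/fP => //.
  rewrite G'P //; split=> -[Xx].
    by rewrite fP.
  by move=> <-; split=> //; apply/fP.
split.
- by move=> x Xx; exists (f x); split; [apply: fim|apply/fP].
- by move=> x y y' Xx /fP-> // /fP->.
- by move=> y /fsurj[x Xx <-]; exists x; split=> //; apply/fP.
- by move=> x x' y Xx Xx' /fP-> // /fP e; apply: finj; rewrite ?inE // e.
- move=> y x Yy; rewrite f'P //; split=> -[Xx].
    by move=> <-; split=> //; apply/fP.
  by rewrite fP.
Qed.

End FirstOrder.

Section Elementary.
Variable F : closedFieldType.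

Lemma base_model_acf : acf (base_model F).
Proof. exact: Acf. Qed.

(** The negation of the conclusion, that some point of M is not in S, is
    equivalent to a quantifier free formula p without variables; the truth value
    of p is the same in M as in F. *)
Lemma qf_definable_transfer n (S : uniform_set F n) (M : model F) :
    qf_definable S -> acf M ->
  (forall v, S (base_model F) v) -> forall v, S M v.
Proof.
move=> dS MK SF v.
have [p pS] : qf_definable (fun M (_ : 'rV[M]_0) => exists w : 'rV[M]_n, ~ S M w).
  have dN := qf_definable_sel (selectionr (n:=0) (selection_id F (0 + n)))
               (qf_definable_not dS).
  apply: qf_definable_ext (qf_definable_ex dN) => L LK u /=.
  by split=> -[w]; rewrite ?row_mxKr => nS; exists w; rewrite ?row_mxKr.
apply: contrapT => nS; have pM : qf_set p M 0 by apply/pS => //; exists v.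
suff /(pS _ base_model_acf 0)[w] : qf_set p (base_model F) 0 by apply.
have evE f : peval (0 : 'rV[M]_0) f = 0 <-> peval (0 : 'rV[base_model F]_0) f = 0.
  have <- : Defs.scalar M (peval (0 : 'rV[base_model F]_0) f) = peval (0 : 'rV[M]_0) f.
    by apply: rmorph_mmap => // -[].
  split=> [/eqP|->]; last by rewrite rmorph0.
  case: MK => K i /=; rewrite fmorph_eq0 => /eqP //.
move: pM; rewrite /qf_set /=.
have evp (q : qf F 0) : bool_sem (fun f => peval (0 : 'rV[M]_0) f = 0) q <->
    bool_sem (fun f => peval (0 : 'rV[base_model F]_0) f = 0) q.
  elim: q => [f|q IHq|q IHq r IHr|q IHq r IHr] /=; first exact: evE.
  - by rewrite IHq.
  - by rewrite IHq IHr.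
  - by rewrite IHq IHr.
by rewrite evp.
Qed.

Lemma qf_set_eq_points n (p q : qf F n) :
    qf_set p (base_model F) = qf_set q (base_model F) ->
  forall M, acf M -> qf_set p M = qf_set q M.
Proof.
move=> pq M MK; apply/predeqP.
apply: (@qf_definable_transfer _ (fun M v => qf_set p M v <-> qf_set q M v)) => //.
  by apply: qf_definable_iff; apply: qf_definable_qf.
by move=> v; rewrite pq.
Qed.

Lemma bij_graph_transfer n k (p : qf F n) (q : qf F k)
    (th : schemic F (n + k)) (th' : schemic F (k + n)) :
  let graph M := bij_graph (qf_set p M) (qf_set q M)
    (fun x y => schemic_set th M (row_mx x y))
    (fun y x => schemic_set th' M (row_mx y x)) in
  graph (base_model F) -> forall M, acf M -> graph M.
Proof.
move=> graph [tot func surj inj inv] M MK.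
have id_sel N := selection_id F N.
split.
- apply: (@qf_definable_transfer _ (fun M x => qf_set p M x ->
    exists y, qf_set q M y /\ schemic_set th M (row_mx x y))) MK tot.
  apply: qf_definable_imp; first exact: qf_definable_qf.
  have d := qf_definable_ex (qf_definable_and
    (qf_definable_sel (selectionr (id_sel (n + k))) (qf_definable_qf q))
    (qf_definable_schemic th)).
  by apply: qf_definable_ext d => L _ x /=; split=> -[y]; rewrite ?row_mxKr; exists y;
    rewrite ?row_mxKr.
- (* The vector u stands for ((x, y), y'). *)
  move=> x y y' px xy xy'; pose S (M : model F) (u : 'rV[M]_(n + k + k)) :=
    qf_set p M (lsubmx (lsubmx u)) -> schemic_set th M (lsubmx u) ->
    schemic_set th M (row_mx (lsubmx (lsubmx u)) (rsubmx u)) ->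
    rsubmx (lsubmx u) = rsubmx u.
  have sel1 := selectionl (id_sel (n + k + k)).
  suff /(_ (row_mx (row_mx x y) y')) : forall u, S M u.
    by rewrite /S !row_mxKl !row_mxKr; apply.
  apply: (@qf_definable_transfer _ S) => // [|u pu].
    apply: qf_definable_imp (qf_definable_sel (selectionl sel1) (qf_definable_qf p)) _.
    apply: qf_definable_imp (qf_definable_sel sel1 (qf_definable_schemic th)) _.
    apply: qf_definable_imp (qf_definable_eq (selectionr sel1) (selectionr (id_sel _))).
    exact: qf_definable_sel (selection_row_mx (selectionl sel1) (selectionr (id_sel _)))
      (qf_definable_schemic th).
  by rewrite -{1}[lsubmx u]hsubmxK; apply: func.
- apply: (@qf_definable_transfer _ (fun M y => qf_set q M y ->
    exists x, qf_set p M x /\ schemic_set th M (row_mx x y))) MK surj.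
  apply: qf_definable_imp; first exact: qf_definable_qf.
  have d := qf_definable_ex (qf_definable_and
    (qf_definable_sel (selectionr (id_sel (k + n))) (qf_definable_qf p))
    (qf_definable_sel (selection_row_mx (selectionr (id_sel (k + n)))
      (selectionl (id_sel (k + n)))) (qf_definable_schemic th))).
  by apply: qf_definable_ext d => L _ y /=; split=> -[x]; rewrite ?row_mxKr ?row_mxKl;
    exists x; rewrite ?row_mxKr ?row_mxKl.
- (* The vector u stands for ((x, y), x'). *)
  move=> x x' y px px' xy xy'; pose S (M : model F) (u : 'rV[M]_(n + k + n)) :=
    qf_set p M (lsubmx (lsubmx u)) -> qf_set p M (rsubmx u) ->
    schemic_set th M (lsubmx u) ->
    schemic_set th M (row_mx (rsubmx u) (rsubmx (lsubmx u))) ->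
    lsubmx (lsubmx u) = rsubmx u.
  have sel1 := selectionl (id_sel (n + k + n)).
  have sel2 := selectionr (id_sel (n + k + n)).
  suff /(_ (row_mx (row_mx x y) x')) : forall u, S M u.
    by rewrite /S !row_mxKl !row_mxKr; apply.
  apply: (@qf_definable_transfer _ S) => // [|u pu pu'].
    apply: qf_definable_imp (qf_definable_sel (selectionl sel1) (qf_definable_qf p)) _.
    apply: qf_definable_imp (qf_definable_sel sel2 (qf_definable_qf p)) _.
    apply: qf_definable_imp (qf_definable_sel sel1 (qf_definable_schemic th)) _.
    apply: qf_definable_imp (qf_definable_eq (selectionl sel1) sel2).
    exact: qf_definable_sel (selection_row_mx sel2 (selectionr sel1))
      (qf_definable_schemic th).
  by rewrite -{1}[lsubmx u]hsubmxK; apply: inj.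
- move=> y x qy; pose S (M : model F) (u : 'rV[M]_(k + n)) := qf_set q M (lsubmx u) ->
    schemic_set th' M u <->
    qf_set p M (rsubmx u) /\ schemic_set th M (row_mx (rsubmx u) (lsubmx u)).
  have sell := selectionl (id_sel (k + n)); have selr := selectionr (id_sel (k + n)).
  suff /(_ (row_mx y x)) : forall u, S M u.
    by rewrite /S !row_mxKl !row_mxKr; apply.
  apply: (@qf_definable_transfer _ S) => // [|u qu].
    apply: qf_definable_imp (qf_definable_sel sell (qf_definable_qf q)) _.
    apply: qf_definable_iff (qf_definable_schemic th') _.
    apply: qf_definable_and (qf_definable_sel selr (qf_definable_qf p)) _.
    exact: qf_definable_sel (selection_row_mx selr sell) (qf_definable_schemic th).
  by rewrite -{1}[u]hsubmxK; apply: inv.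
Qed.

End Elementary.

(** * F as an Artinian local F-algebra *)

Section PointModel.
Variable F : fieldType.

(** F as a module over itself: unlike base_model F, this is literally one of the
    finite dimensional algebras.  As the carriers are convertible, the sets
    defined by a formula in the two models can be compared without a map between
    them. *)
Definition point_model : model F := @alg_model F F^o (@mulrC F).

Lemma point_model_artin : artin point_model.
Proof.
apply: Artin => x y; rewrite !unitfE !negbK => /eqP-> /eqP->.
by rewrite addr0.
Qed.

Lemma peval_point n (v : 'rV[F]_n) (p : {mpoly F[n]}) :
  @peval F point_model n v p = @peval F (base_model F) n v p.
Proof. by apply: eq_bigr => m _; congr (_ * _); apply: mulr1. Qed.

Lemma schemic_set_point n (s : schemic F n) :
  schemic_set s point_model = schemic_set s (base_model F).
Proof.
by apply/predeqP => v; split=> sv f /sv; [rewrite -peval_point|rewrite peval_point].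
Qed.

Lemma ppb_set_point n (p : ppb F n) :
  ppb_set p point_model = ppb_set p (base_model F).
Proof.
rewrite /ppb_set; apply/predeqP => v /=.
elim: p => [a|p IHp|p IHp q IHq|p IHp q IHq] /=.
- by rewrite /pp_set schemic_set_point.
- by rewrite IHp.
- by rewrite IHp IHq.
- by rewrite IHp IHq.
Qed.

Lemma extent_point n (P : set (ppb F n)) :
  extent P point_model = extent P (base_model F).
Proof.
by apply/predeqP => v; split=> -[p Pp pv]; exists p; move: pv; rewrite ?ppb_set_point.
Qed.

End PointModel.

(** * The class of the set of F-points *)

Section PointClass.
Variable F : closedFieldType.
Local Notation points P := (extent P (base_model F)).

(** F being Artinian, P(F) is already the set of F-points of one of the formulae
    in P. *)
Lemma points_qf n (P : formulary F n) :
  exists p : qf F n, qf_set p (base_model F) = points P.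
Proof.
have [phi Pphi phiP] := formularyP P (point_model_artin F).
have [p pP] := qf_definable_ppb phi.
exists p; apply/predeqP => v; rewrite (pP _ (base_model_acf F)).
by rewrite -ppb_set_point phiP extent_point.
Qed.

Definition point_formula n (P : formulary F n) : qf F n :=
  projT1 (cid (points_qf P)).

Lemma point_formulaP n (P : formulary F n) :
  qf_set (point_formula P) (base_model F) = points P.
Proof. exact: projT2 (cid (points_qf P)). Qed.

Lemma class_var_eq n (p q : qf F n) :
  qf_set p (base_model F) = qf_set q (base_model F) -> class_var p = class_var q.
Proof.
by move=> pq; apply/pi_eqP/gr_sub_equiv => M; apply: qf_set_eq_points.
Qed.

Definition point_class n (P : formulary F n) : Gr_var F :=
  class_var (point_formula P).

Lemma point_classE n (P : formulary F n) (p : qf F n) :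
  qf_set p (base_model F) = points P -> point_class P = class_var p.
Proof. by move=> pP; apply: class_var_eq; rewrite point_formulaP. Qed.

Lemma point_class_eq n (P Q : formulary F n) :
  points P = points Q -> point_class P = point_class Q.
Proof. by move=> PQ; apply: point_classE; rewrite point_formulaP. Qed.

Lemma point_class_equiv n (P Q : formulary F n) :
  form_equiv (T := pp_theory F) P Q -> point_class P = point_class Q.
Proof.
move=> PQ; apply: point_class_eq; rewrite -!extent_point.
exact: PQ (point_model_artin F).
Qed.

(** The polynomials that define the isomorphism and its inverse in F do so in all
    algebraically closed extensions of F. *)
Lemma point_class_iso n k (P : formulary F n) (Q : formulary F k) :
  schemic_iso (T := pp_theory F) P Q -> point_class P = point_class Q.
Proof.
move=> [th [th' iso]]; apply/pi_eqP/gr_sub_iso; exists th, th' => M MK.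
have /bij_graphP := iso _ (point_model_artin F).
move=> /(_ 0) graph; apply/(bij_graphP _ _ 0).
apply: bij_graph_transfer MK.
rewrite !point_formulaP.
by move: graph; rewrite /form_set /= !extent_point !schemic_set_point.
Qed.

Lemma point_class_or n (P Q : formulary F n) :
  point_class (Formulary (fml_orP P Q)) =
  class_var (BOr (point_formula P) (point_formula Q)).
Proof.
apply: point_classE; rewrite -extent_point extent_or; last exact: point_model_artin.
by rewrite extent_setU !extent_point -!point_formulaP.
Qed.

Lemma point_class_and n (P Q : formulary F n) :
  point_class (Formulary (fml_andP P Q)) =
  class_var (BAnd (point_formula P) (point_formula Q)).
Proof.
by apply: point_classE; rewrite extent_and -!point_formulaP.
Qed.

Lemma point_class_prod n k (P : formulary F n) (Q : formulary F k) :
  point_class (Formulary (fml_prodP P Q)) = point_class P * point_class Q.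
Proof.
rewrite /point_class /class_var -gr_class_mul; apply: point_classE.
rewrite extent_prod -!point_formulaP; apply/predeqP => v.
exact: qf_prodP.
Qed.

Lemma point_class_true : point_class (form_true (pp_theory F)) = 1.
Proof.
rewrite -gr_class_true; apply: point_classE; apply/predeqP => v.
rewrite extent1 schemic_ppbP; split=> // _.
by rewrite /qf_set /= raddf0.
Qed.

Lemma point_class_scissor n (P Q : formulary F n) :
  point_class (Formulary (fml_orP P Q)) + point_class (Formulary (fml_andP P Q))
    - point_class P - point_class Q = 0.
Proof.
rewrite point_class_or point_class_and /point_class /class_var /gr_class.
rewrite -raddfD -!raddfB -(raddf0 (\pi_(Gr_var F))).
apply/pi_eqP; rewrite subr0; apply: gr_sub_rel.
exact: (@gr_scissor _ (var_theory F)).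
Qed.

Local Notation combination := {freeg (generator (pp_theory F)) / int}.

Definition point_sum (a : combination) : Gr_var F :=
  fglift (fun x : generator (pp_theory F) =>
    point_class (projT2 x) : zmodule (Gr_var F)) a.

Lemma point_sumB a b : point_sum (a - b) = point_sum a - point_sum b.
Proof. exact: (@fglift_additive _ (pp_theory F) (zmodule (Gr_var F))). Qed.

Lemma point_sum0 : point_sum 0 = 0.
Proof. by have := point_sumB 0 0; rewrite !subrr. Qed.

Lemma point_sumD a b : point_sum (a + b) = point_sum a + point_sum b.
Proof. by rewrite -{1}[b]opprK -[- b]sub0r !point_sumB point_sum0 sub0r opprK. Qed.

Lemma point_sum_gen n (P : formulary F n) :
  point_sum (gen (T := pp_theory F) P) = point_class P.
Proof. exact: (@fglift_gen _ (pp_theory F) (zmodule (Gr_var F))). Qed.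

Lemma point_sum_rel a : a \in gr_sub (T := pp_theory F) -> point_sum a = 0.
Proof.
pose I : {pred combination} := fun a => point_sum a == 0.
move=> /subgroup_genP/(_ I) aI; apply/eqP; apply: aI => [|b].
  split=> [|b c /eqP b0 /eqP c0]; first by rewrite unfold_in point_sum0.
  by rewrite unfold_in point_sumB b0 c0 subrr.
case=> [n P Q PQ|n k P Q PQ|n P Q];
    rewrite unfold_in !point_sumB ?point_sumD !point_sum_gen.
- by rewrite (point_class_equiv PQ) subrr.
- by rewrite (point_class_iso PQ) subrr.
- by apply/eqP; apply: point_class_scissor.
Qed.

Lemma point_sumM a b : point_sum (freeg_mul a b) = point_sum a * point_sum b.
Proof.
elim/freeg_gen_ind: a => [|a a' IHa IHa'|n P].
- by rewrite freeg_mul0l point_sum0 mul0r.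
- by rewrite freeg_mulBl !point_sumB IHa IHa' mulrBl.
elim/freeg_gen_ind: b => [|b b' IHb IHb'|k Q].
- by rewrite freeg_mul0r point_sum0 mulr0.
- by rewrite freeg_mulBr !point_sumB IHb IHb' mulrBr.
by rewrite freeg_mul_gen !point_sum_gen; apply: point_class_prod.
Qed.

(** The value does not depend on the representative, by point_sum_rel. *)
Definition spec_pp (a : Gr_pp F) : Gr_var F := point_sum (repr a).

Lemma spec_pp_pi a : spec_pp (\pi_(Gr_pp F) a) = point_sum a.
Proof.
apply/eqP; rewrite -subr_eq0 -point_sumB; apply/eqP/point_sum_rel.
by apply/pi_eqP; rewrite reprK.
Qed.

Lemma spec_pp_class n (P : formulary F n) : spec_pp (class_pp P) = point_class P.
Proof. by rewrite /class_pp /gr_class spec_pp_pi point_sum_gen. Qed.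

Lemma spec_ppB : zmod_morphism spec_pp.
Proof.
elim/quotW=> a; elim/quotW=> b.
by rewrite -raddfB !spec_pp_pi point_sumB.
Qed.

Lemma spec_ppM : monoid_morphism spec_pp.
Proof.
split.
  rewrite -gr_class_true -[LHS]/(spec_pp (class_pp _)) spec_pp_class.
  exact: point_class_true.
elim/quotW=> a; elim/quotW=> b.
rewrite -[_ * _](pi_quot_mul (@freeg_mulDl _ _) (@freeg_mulNl _ _) (@freeg_mulC _ _)).
by rewrite !spec_pp_pi point_sumM.
Qed.

HB.instance Definition _ :=
  GRing.isZmodMorphism.Build (Gr_pp F) (Gr_var F) spec_pp spec_ppB.
HB.instance Definition _ :=
  GRing.isMonoidMorphism.Build (Gr_pp F) (Gr_var F) spec_pp spec_ppM.

(** A point of the k-th neighbourhood is a zero of f ^ k, hence of f, for all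
    equations f of Y; conversely Y is its own first neighbourhood. *)
Lemma total_jet_points n (v y : schemic F n) :
    ideal_gen [set` v] `<=` ideal_gen [set` y] ->
  points (total_jet v y) = schemic_set y (base_model F).
Proof.
move=> vy; apply/predeqP => x; split.
  move=> [_ [s [[k k0 sJ] ->]] /schemic_ppbP/schemic_ideal sx] f fy.
  have : peval x (f ^+ k) = 0.
    apply: sx; rewrite sJ; apply: ideal_gen_sub; right; apply: ideal_gen_sub.
    exists (nseq k f); last by rewrite big_nseq -/(iter _ _ _) iter_mulr_1.
    split=> [|_ /nseqP[-> _]]; first by rewrite size_nseq.
    exact: ideal_gen_sub.
  by rewrite rmorphXn /= => /eqP; rewrite (@expf_eq0 F) => /andP[_ /eqP].
move=> yx; exists (schemic_ppb (v ++ power_gens y 1)).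
  by exists (v ++ power_gens y 1); split=> //; exists 1 => //; apply: jet_idealP.
apply/schemic_ppbP/schemic_cat; split=> f.
  by move=> fv; move/schemic_ideal: yx; apply; apply/vy/ideal_gen_sub.
by move=> /allpairsP[[a b] /= [/yx a0 _ ->]]; rewrite rmorphM /= a0 mul0r.
Qed.

Lemma spec_pp_jet a : a \in jet_nideal (F := F) -> spec_pp a = 0.
Proof.
move=> /in_ideal_genP[s sJ ->]; rewrite raddf_sum big_seq big1 // => -[c d] /sJ /= dJ.
rewrite rmorphM /=; suff -> : spec_pp d = 0 by rewrite mulr0.
case: dJ => n v y vy; rewrite raddfB /= !spec_pp_class.
apply/eqP; rewrite subr_eq0; apply/eqP/point_class_eq.
rewrite total_jet_points //; apply/predeqP => x.
by rewrite extent1 schemic_ppbP.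
Qed.

(** The value does not depend on the representative, by spec_pp_jet. *)
Definition spec_form (a : Gr_form F) : Gr_var F := spec_pp (repr a).

Lemma spec_form_pi a : spec_form (\pi_(Gr_form F) a) = spec_pp a.
Proof.
apply/eqP; rewrite -subr_eq0 -raddfB; apply/eqP/spec_pp_jet.
by apply/pi_eqP; rewrite reprK.
Qed.

Lemma pi_formM : monoid_morphism (\pi_(Gr_form F) : Gr_pp F -> Gr_form F).
Proof.
split=> // a b.
exact: (pi_quot_mul (@mulrDl (Gr_pp F)) (@jet_nidealM F)
  (fun a b => jet_nideal0 (mulrC a b))).
Qed.

Lemma spec_formB : zmod_morphism spec_form.
Proof.
elim/quotW=> a; elim/quotW=> b.
by rewrite -raddfB !spec_form_pi raddfB.
Qed.

Lemma spec_formM : monoid_morphism spec_form.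
Proof.
split; first by rewrite -pi_formM.1 spec_form_pi rmorph1.
elim/quotW=> a; elim/quotW=> b.
by rewrite -pi_formM.2 !spec_form_pi rmorphM.
Qed.

HB.instance Definition _ :=
  GRing.isZmodMorphism.Build (Gr_form F) (Gr_var F) spec_form spec_formB.
HB.instance Definition _ :=
  GRing.isMonoidMorphism.Build (Gr_form F) (Gr_var F) spec_form spec_formM.

Definition quo_form (a : Gr_pp F) : Gr_form F := \pi_(Gr_form F) a.

HB.instance Definition _ :=
  GRing.isZmodMorphism.Build (Gr_pp F) (Gr_form F) quo_form
    (raddfB (\pi_(Gr_form F))).
HB.instance Definition _ :=
  GRing.isMonoidMorphism.Build (Gr_pp F) (Gr_form F) quo_form pi_formM.

End PointClass.

Theorem proposition9p1 (F : closedFieldType) :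
  exists (quo : {rmorphism Gr_pp F -> Gr_form F})
         (spec : {rmorphism Gr_form F -> Gr_var F}),
    (forall a : Gr_pp F, quo a = \pi_(Gr_form F) a) /\
    (forall (n : nat) (P : formulary F n),
       (exists p : qf F n, qf_set p (base_model F) = extent P (base_model F)) /\
       (forall p : qf F n, qf_set p (base_model F) = extent P (base_model F) ->
          spec (quo (class_pp P)) = class_var p)).
Proof.
exists (@quo_form F), (@spec_form F); split=> // n P; split=> [|p pP].
  exact: points_qf.
by rewrite /= spec_form_pi spec_pp_class; apply: point_classE.
Qed.
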